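(* Let $A\in\{0,1\}$ and assume: (consistency) $Y=Y(A)$; (latent ignorability) for each $a$, $Y(a)$ is conditionally independent of $\{A,Z\}$ given $(U,L)$; (IV independence) $Z$ is conditionally independent of $U$ given $L$. For a regular weighting function $\pi(Z,L)$ for $A$ let $\psi_\pi^o:=\mathbb{E}[\gamma_\pi^o(L)]$ and $$\varphi_\pi(O;\psi_\pi^o,\alpha_\pi^o):=\frac{\pi(Z,L)-\rho^o_\pi(L)}{\kappa^o_\pi(L)}\{Y-\eta^o(L)\}-\psi^o_\pi+\left(1-\frac{\{\pi(Z,L)-\rho^o_\pi(L)\}\{A-\delta^o(L)\}}{\kappa^o_\pi(L)}\right)\gamma^o_\pi(L).$$ Suppose that the solution $f^o(A,L)$ to the equation $\mathbb{E}[Y\mid Z,L]=\mathbb{E}[f^o(A,L)\mid Z,L]$ satisfies that $\mathbb{E}[\{Y-f^o(A,L)\}^2\mid Z,L]$ is conditionally independent of $Z$ given $L$. Then, over all regular weighting functions $\pi(Z,L)$ for $A$, the quantity $\mathbb{E}[\varphi_\pi(O;\psi_\pi^o,\alpha_\pi^o)^2]$ reaches its lower bound when $\pi(Z,L)=\Pr(A=1\mid Z,L)$.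
   Context: $O=(Z,A,Y,L)$; $Z$ is an instrument (multi-categorical or continuous), $U$ unmeasured confounders, $L$ observed covariates, $Y\in\mathbb{R}$ the outcome, $Y(a)$ potential outcomes. $\pi(Z,L)$ is a regular weighting function for binary $A$ if it is uniformly bounded and there exists $\epsilon_0>0$ with $|\mathrm{Cov}\{A,\pi(Z,L)\mid L\}|\ge\epsilon_0$ uniformly for all $L$. Nuisance functions: $\delta^o(L)=\mathbb{E}[A\mid L]$, $\eta^o(L)=\mathbb{E}[Y\mid L]$, $\kappa_\pi^o(L)=\mathrm{Cov}\{A,\pi(Z,L)\mid L\}$, $\rho_\pi^o(L)=\mathbb{E}[\pi(Z,L)\mid L]$, $\gamma_\pi^o(L)=\mathrm{Cov}\{Y,\pi(Z,L)\mid L\}/\mathrm{Cov}\{A,\pi(Z,L)\mid L\}$, and $\alpha_\pi^o=[\delta^o,\kappa_\pi^o,\rho_\pi^o,\eta^o,\gamma_\pi^o]$. It is assumed that a regular weighting function for $A$ exists and that a solution $f^o$ exists. *)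

(* Defs.v *)
From HB Require Import structures.
From mathcomp Require Import all_boot all_order all_algebra.
From mathcomp Require Import all_classical all_reals all_analysis measurable_realfun.
Set Implicit Arguments.
Unset Strict Implicit.
Unset Printing Implicit Defensive.
Import Order.TTheory GRing.Theory Num.Theory.
Import numFieldNormedType.Exports.
Local Open Scope classical_set_scope.
Local Open Scope ring_scope.

Section conditional_expectation.
Context d (T : measurableType d) (R : realType) (P : probability T R).
Context d' (T' : measurableType d') (V : T -> T').

(* Conditional expectations given V are represented by measurable functions of
   the values of V: h is a version of E[X | V = .].  Used for measurable X that
   is nonnegative or integrable; a version then exists and is P-almost surely
   unique along V. *)
Definition is_condexp (X : T -> \bar R) (h : T' -> \bar R) : Prop :=
  measurable_fun setT h /\
  forall B : set T', measurable B ->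
    (\int[P]_(w in V @^-1` B) h (V w) = \int[P]_(w in V @^-1` B) X w)%E.

Definition econdexp (X : T -> \bar R) : T' -> \bar R :=
  xget (cst 0%E) [set h | is_condexp X h].

Definition condexp (X : T -> R) : T' -> R :=
  fun v => fine (econdexp (fun w => (X w)%:E) v).

Definition condprob (E : set T) : T' -> R := condexp (\1_E).

Definition condcov (X W : T -> R) : T' -> R :=
  condexp (fun w => (X w - condexp X (V w)) * (W w - condexp W (V w))).

End conditional_expectation.

Definition condindep d (T : measurableType d) (R : realType)
    (P : probability T R)
    d1 (T1 : measurableType d1) d2 (T2 : measurableType d2)
    d3 (T3 : measurableType d3) (X : T -> T1) (W : T -> T2) (V : T -> T3)
    : Prop :=
  forall (B : set T1) (C : set T2), measurable B -> measurable C ->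
    {ae P, forall w,
      condprob P V (X @^-1` B `&` W @^-1` C) (V w) =
      condprob P V (X @^-1` B) (V w) * condprob P V (W @^-1` C) (V w)}.

Record nuisance (TL : Type) (R : Type) := Nuisance {
  nu_delta : TL -> R;
  nu_kappa : TL -> R;
  nu_rho : TL -> R;
  nu_eta : TL -> R;
  nu_gamma : TL -> R
}.

Definition phi (TZ TL : Type) (R : realType) (pi : TZ * TL -> R)
    (psi : R) (alpha : nuisance TL R) (z : TZ) (a : bool) (y : R) (l : TL) : R :=
  (pi (z, l) - nu_rho alpha l) / nu_kappa alpha l * (y - nu_eta alpha l)
  - psi
  + (1 - (pi (z, l) - nu_rho alpha l) * (a%:R - nu_delta alpha l)
           / nu_kappa alpha l) * nu_gamma alpha l.

Section weighting.
Context d (T : measurableType d) (R : realType) (P : probability T R).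
Context dZ (TZ : measurableType dZ) dL (TL : measurableType dL).
Variables (Z : T -> TZ) (A : T -> bool) (Y : T -> R) (L : T -> TL).

Let A01 : T -> R := fun w => (A w)%:R.
Let weight (pi : TZ * TL -> R) : T -> R := fun w => pi (Z w, L w).

(* Both bounds are almost sure ones, since conditional covariances and
   Pr(A = 1 | Z, L) are determined only up to null sets. *)
Definition regular_weight (pi : TZ * TL -> R) : Prop :=
  [/\ measurable_fun setT pi,
      exists M : R, {ae P, forall w, `|pi (Z w, L w)| <= M} &
      exists2 e0 : R, 0 < e0 &
        {ae P, forall w, e0 <= `|condcov P L A01 (weight pi) (L w)|}].

Definition true_nuisance (pi : TZ * TL -> R) : nuisance TL R :=
  {| nu_delta := condexp P L A01;
     nu_kappa := condcov P L A01 (weight pi);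
     nu_rho := condexp P L (weight pi);
     nu_eta := condexp P L Y;
     nu_gamma := fun l =>
       condcov P L Y (weight pi) l / condcov P L A01 (weight pi) l |}.

Definition true_psi (pi : TZ * TL -> R) : R :=
  fine ('E_P[fun w => nu_gamma (true_nuisance pi) (L w)])%E.

Definition true_phi (pi : TZ * TL -> R) : T -> R :=
  fun w => phi pi (true_psi pi) (true_nuisance pi) (Z w) (A w) (Y w) (L w).

Definition propensity : TZ * TL -> R :=
  condprob P (fun w => (Z w, L w)) (A @^-1` [set true]).

End weighting.

(* Main.v *)
Require Import Defs.
From HB Require Import structures.
From mathcomp Require Import all_boot all_order all_algebra.
From mathcomp Require Import all_classical all_reals all_analysis measurable_realfun.
From mathcomp Require Import ring lra.
Import Order.TTheory GRing.Theory Num.Theory.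
Import numFieldNormedType.Exports.
Local Open Scope classical_set_scope.
Local Open Scope ring_scope.
Set Implicit Arguments.
Unset Strict Implicit.
Unset Printing Implicit Defensive.

(** Write e = Y - f(A, L), so that E[e | Z, L] = 0, and g(L) = f(1, L) - f(0, L).
For every regular weighting function pi, gamma_pi = g and
phi_pi = (g - E g) + r_pi e with r_pi = (pi - rho_pi) / kappa_pi, a bounded
function of (Z, L).  The two terms are orthogonal, so only E[r_pi^2 e^2] depends
on pi.  The homoscedasticity assumption makes E[e^2 | Z, L] a function s(L), and
E[r_pi^2 e^2] = E[r_pi^2 s(L)].  With p = Pr(A = 1 | Z, L) one has
E[r_pi (p - delta) | L] = 1, and r_p is a multiple of p - delta by a function of
L, so r_pi - r_p is orthogonal to r_p given L and E[r_p^2 | L] <= E[r_pi^2 | L].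
Neither g - E g nor e is assumed to be square integrable. *)

(** * Integrals of functions weighted by a function of V *)

(** Only [Y] and [f(A, L)] are assumed integrable. So E[phi_pi^2] may be infinite, the cross term 2
    (g - E g) r_pi e need not be integrable, and E[e^2 | Z, L] may take the value +oo. Two devices
    remove these obstacles. An inequality between the integrals of two nonnegative variables over
    all events of [V] survives multiplication by any nonnegative function of [V], infinite values
    included; factors that depend on [V] alone can thus be split off and restored without any
    integrability. And s(L) is never constructed: the indicator of each event of the conditional
    variance is almost surely a function of L, which is enough to compare integrals. The regularity
    of Pr(A = 1 | Z, L) itself comes from the one regular weight assumed to exist: given L, the
    covariance of that weight with A equals its covariance with the propensity, so Cauchy-Schwarz
    bounds the conditional variance of the propensity from below. *)

Section composite_weight.
Context d (T : measurableType d) (R : realType) (P : {measure set T -> \bar R}).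
Context d' (T' : measurableType d') (V : T -> T').
Hypothesis mV : measurable_fun setT V.
Implicit Types X : T -> \bar R.

Import HBNNSimple.
Local Open Scope ereal_scope.

Lemma measurable_preimageT (B : set T') : measurable B -> measurable (V @^-1` B).
Proof. by move=> mB; rewrite -[V @^-1` B]setTI; exact: mV. Qed.

Lemma integral_nnsfun_comp (h : {nnsfun T' >-> R}) X :
  measurable_fun setT X -> (forall w, 0 <= X w) ->
  \int[P]_w ((h (V w))%:E * X w) =
  \sum_(y \in range h) (y%:E * \int[P]_(w in V @^-1` (h @^-1` [set y])) X w).
Proof.
move=> mX X0.
have mi y : measurable_fun setT (fun w => (y * \1_(h @^-1` [set y]) (V w))%:E).
  apply/measurable_EFinP/measurable_funM => //.
  by apply: (measurableT_comp _ mV); exact: measurable_indic.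
transitivity (\int[P]_w \sum_(y \in range h)
    ((y * \1_(h @^-1` [set y]) (V w))%:E * X w)).
  apply: eq_integral => w _.
  rewrite -ge0_mule_fsuml => [|y]; last exact: nnfun_muleindic_ge0.
  by rewrite fsumEFin// -(fimfunE _ (V w)).
rewrite ge0_integral_fsum//; last 2 first.
- by move=> y; exact: emeasurable_funM.
- by move=> y w _; rewrite mule_ge0// nnfun_muleindic_ge0.
apply: eq_fsbigr => y; rewrite inE => -[t _ <-].
under eq_integral do rewrite EFinM -muleA.
rewrite ge0_integralZl//.
- congr (_ * _); rewrite [RHS]integral_mkcond; apply: eq_integral => w _.
  by rewrite epatch_indic muleC/= indicE.
- apply: emeasurable_funM => //; apply/measurable_EFinP.
  by apply: (measurableT_comp _ mV); exact: measurable_indic.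
- by move=> w _; rewrite mule_ge0// lee_fin.
- by rewrite lee_fin.
Qed.

(** For a simple weight the integral is a nonnegative combination of integrals over preimages under
    [V]; monotone convergence passes to general [k]. Every value and integral may be [+oo]. Two
    opposite applications give equalities. *)
Lemma ge0_le_integral_comp X X' (k : T' -> \bar R) :
  measurable_fun setT X -> (forall w, 0 <= X w) ->
  measurable_fun setT X' -> (forall w, 0 <= X' w) ->
  measurable_fun setT k -> (forall v, 0 <= k v) ->
  (forall B, measurable B ->
    \int[P]_(w in V @^-1` B) X w <= \int[P]_(w in V @^-1` B) X' w) ->
  \int[P]_w (k (V w) * X w) <= \int[P]_w (k (V w) * X' w).
Proof.
move=> mX X0 mX' X'0 mk k0 XX'.
pose h := nnsfun_approx measurableT mk.
have mh n : measurable_fun setT (fun w => (h n (V w))%:E).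
  by apply/measurable_EFinP; apply: (measurableT_comp _ mV).
have approx Y : measurable_fun setT Y -> (forall w, 0 <= Y w) ->
    \int[P]_w ((h n (V w))%:E * Y w) @[n --> \oo] --> \int[P]_w (k (V w) * Y w).
  move=> mY Y0; have nd w :
      {homo (fun n => (h n (V w))%:E * Y w) : n m / (n <= m)%N >-> n <= m}.
    move=> n m nm; rewrite lee_wpmul2r// lee_fin.
    exact/lefP/nd_nnsfun_approx.
  have -> : \int[P]_w (k (V w) * Y w) =
            \int[P]_w limn (fun n => (h n (V w))%:E * Y w).
    apply: eq_integral => w _; apply/esym/cvg_lim => //.
    have hk := cvg_nnsfun_approx measurableT mk (fun v _ => k0 v) (x := V w) I.
    (* The limit of a product is undetermined only for 0 times infinity, so zero factors are treated
       apart. Where [k] vanishes, so does each approximant, since it lies between 0 and [k]. *)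
    have [Y0'|Y0'] := eqVneq (Y w) 0.
      rewrite Y0' mule0 (_ : (fun n => _) = cst 0); first exact: cvg_cst.
      by apply/funext => n; rewrite mule0.
    have [k0'|k0'] := eqVneq (k (V w)) 0.
      rewrite k0' mul0e (_ : (fun n => _) = cst 0); first exact: cvg_cst.
      apply/funext => n; apply/eqP; rewrite mule_eq0; apply/orP; left.
      rewrite eq_le; apply/andP; split; last by rewrite lee_fin.
      by rewrite -k0' /h nnsfun_approxE; exact: le_approx.
    apply: cvgeM => //; last exact: cvg_cst.
    by case: (k (V w)) (Y w) k0' Y0' => [r||] [s||].
  apply: cvg_monotone_convergence => //.
  - by move=> n; exact: emeasurable_funM.
  - by move=> n w _; rewrite mule_ge0// lee_fin.
refine (lee_cvg_to (approx X mX X0) (approx X' mX' X'0) _).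
apply: nearW => n; rewrite !integral_nnsfun_comp//.
apply: lee_fsum => // _ [t _ <-].
rewrite lee_wpmul2l ?lee_fin//; exact/XX'/measurable_sfunP.
Qed.
End composite_weight.

(** * Existence of conditional expectations *)

Section condexp_integrable_ge0.
Context d (T : measurableType d) (R : realType) (P : probability T R).
Context d' (T' : measurableType d') (V : T -> T').
Hypothesis mV : measurable_fun setT V.
Variable X : T -> \bar R.
Hypotheses (X0 : forall w, (0 <= X w)%E) (iX : P.-integrable setT X).
Local Open Scope ereal_scope.

(** The image under [V] of the measure with density [X]. Its Radon-Nikodym derivative with respect
    to the law of [V] is a version of E[X | V]. *)
Definition pushforward_density (B : set T') := \int[P]_(w in V @^-1` B) X w.
Local Notation nu := pushforward_density.

Let nu0 : nu set0 = 0.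
Proof. by rewrite /nu preimage_set0 integral_set0. Qed.

Let nu_ge0 B : 0 <= nu B.
Proof. exact: integral_ge0. Qed.

Let nu_sigma_additive : semi_sigma_additive nu.
Proof.
move=> F mF tF mUF; rewrite /nu preimage_bigcup.
apply: semi_sigma_additive_nng_induced => //.
- exact: measurable_int iX.
- by move=> n; exact: measurable_preimageT.
- apply/trivIsetP => /= i j _ _ ij; rewrite -preimage_setI.
  by move/trivIsetP : tF => /(_ _ _ _ _ ij) ->//; rewrite preimage_set0.
- by rewrite -preimage_bigcup; exact: measurable_preimageT.
Qed.

HB.instance Definition _ := isMeasure.Build _ _ _ nu nu0 nu_ge0 nu_sigma_additive.

Let nu_finite : fin_num_fun nu.
Proof.
move=> B mB; apply: integrable_fin_num; first exact: measurable_preimageT.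
by apply: integrableS iX => //; exact: measurable_preimageT.
Qed.

HB.instance Definition _ := @Measure_isFinite.Build _ _ _ nu nu_finite.

Let V' : {RV P >-> T'} := HB.pack V (isMeasurableFun.Build _ _ _ _ _ mV).

(** A null event of the law of [V] has a null preimage, over which [X] integrates to 0, so
    Radon-Nikodym applies. Nonnegativity at every point is recorded because the signed case and the
    non-integrable case are assembled from such versions, by a difference and by a series. *)
Lemma is_condexp_integrable_ge0 : exists h : T' -> \bar R,
  [/\ is_condexp P V X h, forall v, 0 <= h v & forall v, h v \is a fin_num].
Proof.
have nuV : nu `<< distribution P V'.
  apply/null_content_dominatesP => B mB PB.
  apply: null_set_integral => //; first exact: measurable_preimageT.
  exact: measurable_funTS (measurable_int _ iX).
have [h [h0 hfin ih hE]] := radon_nikodym_sigma_finite nuV.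
exists h; split => //; split; first exact: measurable_int ih.
move=> B mB.
rewrite -[RHS]/(nu B) hE// ge0_integral_pushforward//.
exact: measurable_funTS (measurable_int _ ih).
Qed.
End condexp_integrable_ge0.

Section condexp_existence.
Context d (T : measurableType d) (R : realType) (P : probability T R).
Context d' (T' : measurableType d') (V : T -> T').
Hypothesis mV : measurable_fun setT V.
Local Open Scope ereal_scope.

Lemma is_condexp_integrable (X : T -> \bar R) : P.-integrable setT X ->
  exists h : T' -> \bar R, is_condexp P V X h.
Proof.
move=> iX.
have iXp := integrable_funepos measurableT iX.
have iXn := integrable_funeneg measurableT iX.
have [g [[mg gE] g0 gfin]] := is_condexp_integrable_ge0 mV (funepos_ge0 X) iXp.
have [h [[mh hE] h0 hfin]] := is_condexp_integrable_ge0 mV (funeneg_ge0 X) iXn.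
exists (fun v => g v - h v); split; first exact: emeasurable_funB.
move=> B mB; have mVB := measurable_preimageT mV mB.
have int_comp (k : T' -> \bar R) (Y : T -> \bar R) : measurable_fun setT k ->
    (forall v, 0 <= k v) -> (forall w, 0 <= Y w) -> P.-integrable setT Y ->
    (forall B, measurable B -> \int[P]_(w in V @^-1` B) k (V w) =
                               \int[P]_(w in V @^-1` B) Y w) ->
    P.-integrable setT (fun w => k (V w)).
  move=> mk k0 Y0 /integrableP[_ iY] kY; apply/integrableP; split.
    exact: measurableT_comp.
  rewrite (eq_integral (fun w => k (V w))) => [|w _]; last by rewrite gee0_abs.
  have := kY setT measurableT; rewrite preimage_setT => ->.
  by under eq_integral do rewrite -[Y _]gee0_abs//.
have ig := int_comp _ _ mg g0 (funepos_ge0 X) iXp gE.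
have ih := int_comp _ _ mh h0 (funeneg_ge0 X) iXn hE.
rewrite integralB//; [|exact: integrableS ig|exact: integrableS ih].
by rewrite gE// hE// -integralE.
Qed.

(** [X] need not be integrable; the squared residual is the intended case. It is cut into the
    bounded slices n <= X < n + 1, and the versions of the slices are summed, possibly to [+oo]. *)
Lemma is_condexp_ge0 (X : T -> R) : measurable_fun setT X ->
  (forall w, 0 <= X w)%R ->
  exists h : T' -> \bar R, is_condexp P V (EFin \o X) h.
Proof.
move=> mX X0.
pose F n := [set w | (n%:R <= X w < n.+1%:R)%R].
have mF n : measurable (F n).
  rewrite (_ : F n = X @^-1` `[n%:R, n.+1%:R[%classic).
    exact: (measurable_preimageT mX).
  by apply/seteqP; split => w /=; rewrite /F/= in_itv.
have X0' n w : 0 <= (EFin \o X \_ (F n)) w.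
  by rewrite /= lee_fin patchE; case: ifP.
have iXF n : P.-integrable setT (EFin \o X \_ (F n)).
  apply: (@le_integrable _ _ _ P _ measurableT _ (cst n.+1%:R%:E)) => //.
  - apply/measurable_EFinP/(measurable_restrictT _ _).1 => //.
    exact: measurable_funTS.
  - move=> w _; rewrite /= lee_fin [leRHS]ger0_norm//.
    rewrite patchE; case: ifP => [/set_mem/andP[Xn1 /ltW Xn2]|_].
      by rewrite ger0_norm.
    by rewrite normr0.
  - exact: finite_measure_integrable_cst.
have /choice[h hP] n := is_condexp_integrable_ge0 mV (X0' n) (iXF n).
exists (fun v => \sum_(n <oo) h n v); split.
  apply: ge0_emeasurable_sum.
  - by move=> n v _ _; have [] := hP n.
  - by move=> n _; have [[]] := hP n.
move=> B mB; have mVB := measurable_preimageT mV mB.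
rewrite integral_nneseries//; last 2 first.
- move=> n; have [[mh _] _ _] := hP n.
  by apply: measurable_funTS; exact: measurableT_comp.
- by move=> n w _; have [_ ->] := hP n.
transitivity (\sum_(n <oo) \int[P]_(w in V @^-1` B `&` F n) (X w)%:E).
  apply: eq_eseriesr => n _; have [[_ ->//] _ _] := hP n.
  rewrite -restrict_EFin.
  by rewrite integral_mkcondr; apply: eq_integral.
rewrite -ge0_integral_bigcup.
- rewrite -setI_bigcupr (_ : \bigcup_k F k = setT) ?setIT//.
  apply/seteqP; split => // w _; exists (Num.truncn (X w)) => //=.
  by rewrite /F/= truncn_itv.
- by move=> n; exact: measurableI.
- by apply/measurable_EFinP; exact: measurable_funTS.
- by move=> w _; rewrite lee_fin.
- move=> i j _ _ [w [[_ /truncn_def <-] [_ /truncn_def <-]]] //.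
Qed.
End condexp_existence.

(** * Conditionally centered variables *)

Section integrability.
Context d (T : measurableType d) (R : realType) (P : probability T R).
Implicit Types X k : T -> R.

Lemma integrable_measurable X : P.-integrable setT (EFin \o X) ->
  measurable_fun setT X.
Proof. by move=> /(measurable_int _) /measurable_EFinP. Qed.

Lemma ae_le_integrable X X' : measurable_fun setT X ->
  {ae P, forall w, `|X w| <= `|X' w|} -> P.-integrable setT (EFin \o X') ->
  P.-integrable setT (EFin \o X).
Proof.
move=> mX XX' iX'; have mX' := integrable_measurable iX'.
apply/integrableP; split; first exact/measurable_EFinP.
move/integrableP : iX' => [_]; apply: le_lt_trans.
apply: ae_ge0_le_integral => //.
- exact/measurableT_comp/measurable_EFinP.
- exact/measurableT_comp/measurable_EFinP.
- by apply: filterS XX' => w h _; rewrite lee_fin.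
Qed.

Lemma ae_bounded_integrable X (M : R) : measurable_fun setT X ->
  {ae P, forall w, `|X w| <= M} -> P.-integrable setT (EFin \o X).
Proof.
move=> mX XM; apply: (@ae_le_integrable _ (cst M)) => //.
- by apply: filterS XM => w h; rewrite (le_trans h)// ler_norm.
- exact: finite_measure_integrable_cst.
Qed.

Lemma ae_bounded_integrableM X k (M : R) : measurable_fun setT k ->
  {ae P, forall w, `|k w| <= M} -> P.-integrable setT (EFin \o X) ->
  P.-integrable setT (EFin \o (fun w => k w * X w)).
Proof.
move=> mk kM iX; have mX := integrable_measurable iX.
apply: (@ae_le_integrable _ (fun w => M * X w)).
- exact: measurable_funM.
- by apply: filterS kM => w h; rewrite !normrM ler_wpM2r// (le_trans h)// ler_norm.
- exact: (integrableZl measurableT M iX).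
Qed.

Lemma integrable_comp_ge0_eq0 X : P.-integrable setT (EFin \o X) ->
  {ae P, forall w, 0 <= X w} -> (\int[P]_w (X w)%:E = 0)%E ->
  {ae P, forall w, X w = 0}.
Proof.
move=> iX X0 intX; have mX := measurable_int _ iX.
have : ae_eq P setT (EFin \o X) (cst 0%E).
  apply/(ae_eq_integral_abs P measurableT mX); rewrite -[RHS]intX.
  apply: ae_eq_integral => //; first exact: measurableT_comp.
  by apply: filterS X0 => w h _; rewrite /= ger0_norm.
by apply: filterS => w /(_ I) [].
Qed.
End integrability.

Section conditionally_centered.
Context d (T : measurableType d) (R : realType) (P : probability T R).
Context d' (T' : measurableType d').
Implicit Types (X : T -> R) (V : T -> T') (k : T' -> R).

(* E[X | V] = 0.  An almost sure equation E[X | V] = k(V) is expressed below as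
   cond_centered V (X - k(V)), which does not refer to a chosen version. *)
Definition cond_centered V X : Prop :=
  P.-integrable setT (EFin \o X) /\
  forall B, measurable B -> (\int[P]_(w in V @^-1` B) (X w)%:E = 0)%E.

Variable V : T -> T'.
Hypothesis mV : measurable_fun setT V.

Lemma cond_centered_integral X : cond_centered V X -> (\int[P]_w (X w)%:E = 0)%E.
Proof. by move=> [_ /(_ setT measurableT)]; rewrite preimage_setT. Qed.

Lemma cond_centeredD X X' : cond_centered V X -> cond_centered V X' ->
  cond_centered V (fun w => X w + X' w).
Proof.
move=> [iX X0] [iX' X'0]; split; first exact: (integrableD measurableT iX iX').
move=> B mB; have mVB := measurable_preimageT mV mB.
under eq_integral do rewrite EFinD.
rewrite integralD//; [|exact: integrableS iX|exact: integrableS iX'].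
by rewrite X0// X'0// adde0.
Qed.

Lemma cond_centeredN X : cond_centered V X -> cond_centered V (fun w => - X w).
Proof.
move=> [iX X0]; split.
  by rewrite (_ : EFin \o _ = -%E \o (EFin \o X)); first exact: integrableN.
move=> B mB; have mVB := measurable_preimageT mV mB.
under eq_integral do rewrite -mulN1r EFinM.
by rewrite integralZl ?X0 ?mule0//; exact: integrableS iX.
Qed.

Lemma cond_centeredB X X' : cond_centered V X -> cond_centered V X' ->
  cond_centered V (fun w => X w - X' w).
Proof. by move=> cX /cond_centeredN; exact: cond_centeredD. Qed.

Lemma cond_centered_ae X X' : measurable_fun setT X' ->
  {ae P, forall w, X w = X' w} -> cond_centered V X -> cond_centered V X'.
Proof.
move=> mX' XX' [iX X0]; have mX := integrable_measurable iX; split.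
  by apply: ae_le_integrable iX => //; apply: filterS XX' => w ->.
move=> B mB; have mVB := measurable_preimageT mV mB.
rewrite -(X0 _ mB); apply: ae_eq_integral => //.
- by apply/measurable_EFinP; exact: measurable_funTS.
- by apply/measurable_EFinP; exact: measurable_funTS.
- by apply: filterS XX' => w -> _.
Qed.

(** Being centered means that the positive and negative parts of [X] have equal integrals over all
    preimages under [V]. Equality persists under the weight [k(V)], and integrability of [k(V) X]
    allows the two sides to be subtracted. *)
Let integral_weight_ge0 k X : measurable_fun setT k -> (forall v, 0 <= k v) ->
  P.-integrable setT (EFin \o (fun w => k (V w) * X w)) ->
  cond_centered V X -> (\int[P]_w (k (V w) * X w)%:E = 0)%E.
Proof.
move=> mk k0 ikX [iX X0]; have mX := measurable_int _ iX.
have mXp := measurable_funepos mX; have mXn := measurable_funeneg mX.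
have XpXn B : measurable B ->
    (\int[P]_(w in V @^-1` B) (EFin \o X)^\+%E w =
     \int[P]_(w in V @^-1` B) (EFin \o X)^\-%E w)%E.
  move=> mB; have mVB := measurable_preimageT mV mB.
  have iXB : P.-integrable (V @^-1` B) (EFin \o X) by exact: integrableS iX.
  have := X0 _ mB; rewrite integralE => /eqP.
  have fp := integrable_pos_fin_num mVB iXB.
  have fn := integrable_neg_fin_num mVB iXB.
  rewrite sube_eq ?add0e => [/eqP//|//|].
  by rewrite fin_num_adde_defl.
have mkE : measurable_fun setT (EFin \o k) by exact/measurable_EFinP.
have kE v : (0 <= (EFin \o k) v)%E by rewrite lee_fin.
have posE : (EFin \o (fun w => (k (V w) * X w)%R))^\+%E =
            (fun w => (EFin \o k) (V w) * (EFin \o X)^\+ w)%E.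
  apply/funext => w; rewrite !funeposE/= -!EFin_max -EFinM.
  by rewrite maxr_pMr// mulr0.
have negE : (EFin \o (fun w => (k (V w) * X w)%R))^\-%E =
            (fun w => (EFin \o k) (V w) * (EFin \o X)^\- w)%E.
  apply/funext => w; rewrite !funenegE/= -!EFin_max -EFinM.
  by rewrite maxr_pMr// mulr0 mulrN.
have eq : (\int[P]_w (EFin \o (fun w => (k (V w) * X w)%R))^\+ w =
           \int[P]_w (EFin \o (fun w => (k (V w) * X w)%R))^\- w)%E.
  rewrite posE negE; apply/eqP; rewrite eq_le; apply/andP; split;
  by apply: ge0_le_integral_comp => // B mB; rewrite XpXn.
rewrite integralE eq subee// integrable_neg_fin_num//.
Qed.

(** Taking out what is known, for a possibly unbounded [k] of any sign. The positive and negative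
    parts of [k], restricted to [B], are nonnegative weights, and their products with [X] are
    dominated by the integrable |k(V) X|. *)
Lemma cond_centeredM k X : measurable_fun setT k ->
  P.-integrable setT (EFin \o (fun w => k (V w) * X w)) ->
  cond_centered V X -> cond_centered V (fun w => k (V w) * X w).
Proof.
move=> mk ikX cX; split=> // B mB; have mVB := measurable_preimageT mV mB.
have mX := integrable_measurable cX.1.
have part (h : T' -> R) : measurable_fun setT h -> (forall v, 0 <= h v) ->
    (forall v, h v <= `|k v|) ->
    P.-integrable setT (EFin \o (fun w => h (V w) * \1_B (V w) * X w)) /\
    (\int[P]_w (h (V w) * \1_B (V w) * X w)%:E = 0)%E.
  move=> mh h0 hk.
  have m1 : measurable_fun setT (fun v => h v * \1_B v) by exact: measurable_funM.
  have i1 : P.-integrable setT (EFin \o (fun w => h (V w) * \1_B (V w) * X w)).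
    apply: ae_le_integrable ikX.
    - by apply: measurable_funM => //; exact: (measurableT_comp m1).
    - apply: aeW => w; rewrite !normrM ler_wpM2r//.
      rewrite (ger0_norm (h0 _)) indicE; case: (V w \in B).
        by rewrite normr1 mulr1.
      by rewrite normr0 mulr0.
  split=> //; apply: (integral_weight_ge0 (k := fun v => h v * \1_B v)) => //.
  by move=> v; rewrite mulr_ge0// indicE.
have kpos v : k^\+ v <= `|k v| by rewrite /funrpos ge_max ler_norm normr_ge0.
have kneg v : k^\- v <= `|k v|.
  by rewrite /funrneg ge_max -normrN ler_norm normr_ge0.
have [ip p0] := part _ (measurable_funrpos mk) (funrpos_ge0 k) kpos.
have [iN n0] := part _ (measurable_funrneg mk) (funrneg_ge0 k) kneg.
transitivity (\int[P]_w ((k^\+ (V w) * \1_B (V w) * X w)%:E -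
   (k^\- (V w) * \1_B (V w) * X w)%:E))%E; last by rewrite integralB// p0 n0 sube0.
rewrite integral_mkcond; apply: eq_integral => w _.
rewrite patchE -[w \in _]/(V w \in B) -EFinB -mulrBl -mulrBl.
rewrite -[k^\+ _ - _]/((k^\+ - k^\-) (V w)) funrposBneg indicE.
by case: ifP => _; rewrite ?mulr1// mulr0 mul0r.
Qed.

Lemma cond_centered_bounded_mul k X (M : R) : measurable_fun setT k ->
  {ae P, forall w, `|k (V w)| <= M} -> cond_centered V X ->
  cond_centered V (fun w => k (V w) * X w).
Proof.
move=> mk kM cX; apply: cond_centeredM => //.
by apply: ae_bounded_integrableM kM cX.1; exact: measurableT_comp.
Qed.

(** On the event k(V) < 0 the difference X - k(V) is positive almost surely, yet its integral over
    that event is 0; hence the event is null. Bounds and uniqueness of conditional expectations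
    below all rest on this. *)
Lemma cond_centered_comp_ge0 X k : measurable_fun setT k ->
  P.-integrable setT (EFin \o X) ->
  cond_centered V (fun w => X w - k (V w)) -> {ae P, forall w, 0 <= X w} ->
  {ae P, forall w, 0 <= k (V w)}.
Proof.
move=> mk iX cX X0; pose B := [set v | k v < 0].
have mB : measurable B.
  rewrite (_ : B = k @^-1` `]-oo, 0[%classic); first exact: (measurable_preimageT mk).
  by apply/seteqP; split => v /=; rewrite in_itv.
have cB := cond_centered_bounded_mul (k := \1_B) (M := 1) _ _ cX.
have {}cB : cond_centered V (fun w => \1_B (V w) * (X w - k (V w))).
  apply: cB => //; apply: aeW => w; rewrite indicE.
  by case: (V w \in B); rewrite ?normr1 ?normr0.
have Bge0 : {ae P, forall w, 0 <= \1_B (V w) * (X w - k (V w))}.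
  apply: filterS X0 => w Xw; rewrite indicE.
  case: (boolP (V w \in B)) => [/set_mem kV|_]; last by rewrite mul0r.
  by rewrite mul1r subr_ge0 (le_trans (ltW kV)).
have := integrable_comp_ge0_eq0 cB.1 Bge0 (cond_centered_integral cB).
apply: filterS2 X0 => w Xw; rewrite indicE leNgt => h; apply/negP => kV.
have VB : V w \in B by rewrite inE.
by move: h; rewrite VB mul1r => /eqP; rewrite gt_eqF// subr_gt0 (lt_le_trans kV).
Qed.

Lemma cond_centered_comp_eq0 k : measurable_fun setT k ->
  cond_centered V (fun w => k (V w)) -> {ae P, forall w, k (V w) = 0}.
Proof.
move=> mk ck.
have i0 : P.-integrable setT (EFin \o (cst 0 : T -> R)).
  exact: finite_measure_integrable_cst.
have ge0 h : measurable_fun setT h -> cond_centered V (fun w => h (V w)) ->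
    {ae P, forall w, 0 <= h (V w)}.
  move=> mh ch; apply: (cond_centered_comp_ge0 mh i0); last exact: aeW.
  apply: cond_centered_ae (cond_centeredN ch).
  - by apply: measurable_funB => //; exact: measurableT_comp.
  - by apply: aeW => w; rewrite sub0r.
have k0 := ge0 _ mk ck.
have mNk : measurable_fun setT (fun v => - k v) by exact: measurable_funN.
have := ge0 _ mNk (cond_centeredN ck).
by apply: filterS2 k0 => w k0 k0'; apply/eqP; rewrite eq_le k0 -oppr_ge0 k0'.
Qed.

Lemma cond_centered_tower d'' (T'' : measurableType d'') (W : T -> T'')
    (q : T'' -> T') X : measurable_fun setT q -> (forall w, V w = q (W w)) ->
  (forall B, measurable B -> (\int[P]_(w in W @^-1` B) (X w)%:E = 0)%E) ->
  P.-integrable setT (EFin \o X) -> cond_centered V X.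
Proof.
move=> mq Vq cX iX; split=> // B mB.
rewrite (_ : V @^-1` B = W @^-1` (q @^-1` B)).
  by apply: cX; exact: (measurable_preimageT mq).
by apply/seteqP; split => w /=; rewrite Vq.
Qed.

(** The version is arbitrary and its size is not controlled pointwise. On each of the events h(V) >=
    0 and h(V) < 0, however, the integral of |h(V)| is up to sign that of [X], which is finite. *)
Lemma is_condexp_integrable_comp X (h : T' -> \bar R) :
  P.-integrable setT (EFin \o X) -> is_condexp P V (EFin \o X) h ->
  P.-integrable setT (fun w => h (V w)).
Proof.
move=> iX [mh hE]; have mhV : measurable_fun setT (h \o V) by exact: measurableT_comp.
pose B := [set v | (0 <= h v)%E].
have mB : measurable B by rewrite -[B]setTI; exact: emeasurable_fun_c_infty.
have part D : measurable D -> (\int[P]_(w in V @^-1` D) h (V w) \is a fin_num)%E.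
  move=> mD; rewrite hE// integrable_fin_num//.
    exact: measurable_preimageT.
  by apply: integrableS iX => //; exact: measurable_preimageT.
have mVB := measurable_preimageT mV mB.
apply/integrableP; split => //.
rewrite -(setUv (V @^-1` B)) ge0_integral_setU//.
- rewrite lte_add_pinfty//.
  + rewrite (eq_integral (fun w => h (V w))); first by rewrite ltey_eq part.
    by move=> w /set_mem Bw; rewrite gee0_abs.
  + rewrite (eq_integral (fun w => - h (V w))%E).
      have fin := part _ (measurableC mB).
      have hN : (\int[P]_(w in ~` (V @^-1` B)) h (V w) =
          - (\int[P]_(w in ~` (V @^-1` B)) - h (V w)))%E.
        rewrite -integral_ge0N => [|w Bw].
          by apply: eq_integral => w _; rewrite oppeK.
        by rewrite oppe_ge0 ltW// ltNge; apply/negP.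
      by move: fin; rewrite preimage_setC hN fin_numN ltey_eq => ->.
    by move=> w /set_mem Bw; rewrite lee0_abs// ltW// ltNge; apply/negP.
- exact: measurableC.
- rewrite setUv; exact: measurableT_comp.
- apply/disj_set2P; exact: setICr.
Qed.

Lemma measurable_condexp X : P.-integrable setT (EFin \o X) ->
  measurable_fun setT (condexp P V X).
Proof.
move=> iX; have [mh _] := xgetPex (cst 0%E) (is_condexp_integrable mV iX).
by apply: measurableT_comp mh; exact: fine_measurable.
Qed.

Lemma cond_centered_condexp X : P.-integrable setT (EFin \o X) ->
  cond_centered V (fun w => X w - condexp P V X (V w)).
Proof.
move=> iX; have ceh : is_condexp P V (EFin \o X) (econdexp P V (EFin \o X)).
  exact: xgetPex (is_condexp_integrable mV iX).
have ih := is_condexp_integrable_comp iX ceh; have [mh hE] := ceh.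
(* [condexp] sends infinite values to 0; integrability makes those values negligible. *)
have hfin : {ae P, forall w, (condexp P V X (V w))%:E = econdexp P V (EFin \o X) (V w)}.
  by apply: filterS (integrable_ae measurableT ih) => w /(_ I) fin; rewrite /condexp fineK.
have mc : measurable_fun setT (fun w => condexp P V X (V w)).
  exact: (measurableT_comp (measurable_condexp iX) mV).
have ic : P.-integrable setT (EFin \o (fun w => condexp P V X (V w))).
  apply/integrableP; split; first exact/measurable_EFinP.
  move/integrableP : ih => [_]; congr (_ < _)%E; apply: ae_eq_integral => //.
  - by apply: measurableT_comp => //; exact: (measurableT_comp mh).
  - by apply: measurableT_comp => //; exact/measurable_EFinP.
  - by apply: filterS hfin => w hw _; rewrite /= -hw.
split; first exact: (integrableB measurableT iX ic).
move=> B mB; have mVB := measurable_preimageT mV mB.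
under eq_integral do rewrite EFinB.
rewrite integralB//; [|exact: integrableS iX|exact: integrableS ic].
have iE : (\int[P]_(w in V @^-1` B) (condexp P V X (V w))%:E =
           \int[P]_(w in V @^-1` B) (X w)%:E)%E.
  rewrite -(hE _ mB); apply: ae_eq_integral => //.
  - by apply/measurable_EFinP; exact: measurable_funTS.
  - by apply: measurable_funTS; exact: (measurableT_comp mh).
  - by apply: filterS hfin => w hw _.
rewrite iE subee//; apply: integrable_fin_num => //; exact: integrableS iX.
Qed.

Lemma condexp_ae_eq X k : measurable_fun setT k ->
  P.-integrable setT (EFin \o X) -> cond_centered V (fun w => X w - k (V w)) ->
  {ae P, forall w, condexp P V X (V w) = k (V w)}.
Proof.
move=> mk iX ck; have mc := measurable_condexp iX.
have mck : measurable_fun setT (fun v => condexp P V X v - k v) by exact: measurable_funB.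
have cB := cond_centeredB ck (cond_centered_condexp iX).
have {}cB : cond_centered V (fun w => condexp P V X (V w) - k (V w)).
  apply: cond_centered_ae cB; first exact: (measurableT_comp mck).
  by apply: aeW => w; ring.
by apply: filterS (cond_centered_comp_eq0 mck cB) => w /eqP; rewrite subr_eq0 => /eqP.
Qed.
End conditionally_centered.

(** * Nonnegative conditional expectations with possibly infinite values *)

Section econdexp_weight.
Context d (T : measurableType d) (R : realType) (P : probability T R).
Context d' (T' : measurableType d') (V : T -> T').
Hypothesis mV : measurable_fun setT V.
Local Open Scope ereal_scope.

(* A version of a nonnegative conditional expectation may be negative on a null
   set, hence the positive part. *)
Lemma integral_econdexp_weight (X : T -> R) (k : T' -> \bar R) :
  measurable_fun setT X -> (forall w, 0 <= X w)%R ->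
  measurable_fun setT k -> (forall v, 0 <= k v) ->
  \int[P]_w (k (V w) * (X w)%:E) =
  \int[P]_w (k (V w) * (econdexp P V (EFin \o X))^\+ (V w)).
Proof.
move=> mX X0 mk k0; set S := econdexp _ _ _.
have [mS SE] : is_condexp P V (EFin \o X) S.
  exact: xgetPex (is_condexp_ge0 P mV mX X0).
have mSp : measurable_fun setT (fun w => S^\+ (V w)).
  by apply: (measurableT_comp _ mV); exact: measurable_funepos.
have mXE : measurable_fun setT (EFin \o X) by exact/measurable_EFinP.
have XE0 w : 0 <= (EFin \o X) w by rewrite lee_fin.
pose D := [set v | 0 <= S v].
have mD : measurable D by rewrite -[D]setTI; exact: emeasurable_fun_c_infty.
have eqB B : measurable B -> \int[P]_(w in V @^-1` B) S^\+ (V w) =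
    \int[P]_(w in V @^-1` B) (EFin \o X) w.
  move=> mB; have split (Y : T -> \bar R) : measurable_fun setT Y ->
      (forall w, 0 <= Y w) -> \int[P]_(w in V @^-1` B) Y w =
      \int[P]_(w in V @^-1` (B `&` D)) Y w + \int[P]_(w in V @^-1` (B `\` D)) Y w.
    move=> mY Y0; rewrite -ge0_integral_setU//.
    - by rewrite -preimage_setU setUIDK.
    - by apply: measurable_preimageT => //; exact: measurableI.
    - by apply: measurable_preimageT => //; exact: measurableD.
    - exact: measurable_funTS.
    - apply/disj_set2P; rewrite -preimage_setI setDE setIACA setICr setI0.
      exact: preimage_set0.
  rewrite !split//; congr (_ + _).
    rewrite -SE; last exact: measurableI.
    by apply: eq_integral => w /set_mem[_ Dw]; rewrite funeposE max_l.
  rewrite integral0_eq => [|w [_ /negP Dw]]; last first.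
    by rewrite funeposE max_r// ltW// ltNge.
  (* Where the version is negative its integral is at most 0, while it equals the integral of the
     nonnegative [X]; so the latter is 0. *)
  apply/esym/eqP; rewrite eq_le integral_ge0// andbT -SE; last exact: measurableD.
  have NS w : (V @^-1` (B `\` D)) w -> 0 <= - S (V w).
    by move=> [_ /negP Dw]; rewrite oppe_ge0 ltW// ltNge.
  rewrite (eq_integral (fun w => - - S (V w))) => [|w _]; last by rewrite oppeK.
  by rewrite integral_ge0N// oppe_le0 integral_ge0.
by apply/eqP; rewrite eq_le; apply/andP; split;
  apply: ge0_le_integral_comp => // B mB; rewrite eqB.
Qed.

End econdexp_weight.

(** * Conditioning on the pair (Z, L) and on L *)

Section pair_conditioning.
Context d (T : measurableType d) (R : realType) (P : probability T R).
Context dZ (TZ : measurableType dZ) dL (TL : measurableType dL).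
Variables (Z : T -> TZ) (L : T -> TL).
Hypotheses (mZ : measurable_fun setT Z) (mL : measurable_fun setT L).

(** Measurable rectangles are stable under intersection and generate the product sigma-algebra, and
    the sets over whose preimage [X] integrates to 0 form a Dynkin system. *)
Lemma cond_centered_rectangles (X : T -> R) : P.-integrable setT (EFin \o X) ->
  (forall C B, measurable C -> measurable B ->
    (\int[P]_(w in Z @^-1` C `&` L @^-1` B) (X w)%:E = 0)%E) ->
  cond_centered P (fun w => (Z w, L w)) X.
Proof.
move=> iX X0; set W := fun w => (Z w, L w).
have mW : measurable_fun setT W by exact: measurable_fun_pair.
split=> // D; rewrite measurable_prod_measurableType => mD.
move: D mD; apply: (dynkin_induction (measurable_prod_measurableType TZ TL)).
- move=> _ _ [A1 mA1 [B1 mB1 <-]] [A2 mA2 [B2 mB2 <-]].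
  exists (A1 `&` A2); first exact: measurableI.
  exists (B1 `&` B2); first exact: measurableI.
  by rewrite setXI.
- have := X0 _ _ measurableT measurableT.
  by rewrite !preimage_setT setIT.
- by move=> _ [A mA [B mB <-]]; exact: X0.
- move=> S mS XS; have mWS := measurable_preimageT mW mS.
  have := X0 _ _ measurableT measurableT; rewrite !preimage_setT setIT.
  rewrite -(setUv (W @^-1` S)) integral_setU ?XS ?add0e//.
  - exact: measurableC.
  - rewrite setUv; exact: measurable_int iX.
  - apply/disj_set2P; exact: setICr.
- move=> F mF tF XF; rewrite preimage_bigcup integral_bigcup.
  + by rewrite eseries0.
  + apply/trivIsetP => /= i j _ _ ij; rewrite -preimage_setI.
    by move/trivIsetP : tF => /(_ _ _ _ _ ij) ->//; rewrite preimage_set0.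
  + by move=> k; exact: measurable_preimageT.
  + apply: integrableS iX => //; apply: bigcup_measurable => k _.
    exact: measurable_preimageT.
Qed.

Lemma integrable_indicator (E : set T) : measurable E ->
  P.-integrable setT (EFin \o (\1_E : T -> R)).
Proof.
move=> mE; apply: (@ae_bounded_integrable _ _ _ _ _ 1); first exact: measurable_indic.
by apply: aeW => w; rewrite indicE; case: (w \in E); rewrite ?normr1 ?normr0.
Qed.

Lemma condprob_itv01 (E : set T) : measurable E ->
  {ae P, forall w, 0 <= condprob P L E (L w) <= 1}.
Proof.
move=> mE; have iE := integrable_indicator mE.
have cE := cond_centered_condexp mL iE; have mc := measurable_condexp mL iE.
have ge0 : {ae P, forall w, 0 <= condprob P L E (L w)}.
  by apply: (cond_centered_comp_ge0 mL mc iE cE); apply: aeW => w; rewrite indicE.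
have mc1 : measurable_fun setT (fun v => 1 - condprob P L E v).
  exact: measurable_funB.
have iE1 : P.-integrable setT (EFin \o (fun w => 1 - \1_E w : R)).
  have i1 : P.-integrable setT (EFin \o (cst 1 : T -> R)).
    exact: finite_measure_integrable_cst.
  exact: (integrableB measurableT i1 iE).
have le1 : {ae P, forall w, 0 <= 1 - condprob P L E (L w)}.
  apply: (cond_centered_comp_ge0 mL mc1 iE1).
    apply: (cond_centered_ae mL _ _ (cond_centeredN mL cE)).
      apply: measurable_funB; first exact: (integrable_measurable iE1).
      exact: (measurableT_comp mc1).
    by apply: aeW => w; rewrite /condprob; ring.
  by apply: aeW => w; rewrite indicE; case: (w \in E); rewrite ?subrr ?subr0.
by apply: filterS2 ge0 le1 => w -> /=; rewrite subr_ge0.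
Qed.

(* A function of (Z, L) that is independent of Z given L is independent of
   itself given L, so its events have conditional probability 0 or 1. *)
Lemma condindep_indicator_ae dS (TS : measurableType dS) (S : TZ * TL -> TS) (D : set TS) :
  measurable_fun setT S -> measurable D ->
  condindep P (fun w => S (Z w, L w)) Z L ->
  {ae P, forall w, \1_D (S (Z w, L w)) =
    condprob P L ((fun w => S (Z w, L w)) @^-1` D) (L w)}.
Proof.
move=> mS mD ind; set W := fun w => (Z w, L w).
have mW : measurable_fun setT W by exact: measurable_fun_pair.
set E := (X in condprob P L X); set q := condprob P L E.
have mE : measurable E.
  exact: (measurable_preimageT (measurableT_comp mS mW) mD).
have iE := integrable_indicator mE.
have mq : measurable_fun setT q by exact: measurable_condexp.
have cE := cond_centered_condexp mL iE.
have q1 : {ae P, forall w, `|q (L w)| <= 1}.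
  apply: filterS (condprob_itv01 mE) => w /andP[q0 q1].
  by rewrite ger0_norm.
(* On a rectangle this is the independence hypothesis integrated over an event of [L]. Since 1_E -
   q(L) is itself a function of [(Z, L)], being centered given that pair forces it to vanish. *)
have cW : cond_centered P W (fun w => \1_E w - q (L w)).
  apply: cond_centered_rectangles; first exact: cE.1.
  move=> C B mC mB; have mZC := measurable_preimageT mZ mC.
  have mEC := measurableI _ _ mE mZC.
  have cEC := cond_centered_condexp mL (integrable_indicator mEC).
  have cC := cond_centered_condexp mL (integrable_indicator mZC).
  have c := cond_centeredB mL cEC (cond_centered_bounded_mul mL mq q1 cC).
  have {}c : cond_centered P L (fun w => \1_(Z @^-1` C) w * (\1_E w - q (L w))).
    apply: (cond_centered_ae mL _ _ c).
      apply: measurable_funM; first exact: measurable_indic.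
      exact: integrable_measurable cE.1.
    apply: filterS (ind _ _ mD mC) => w; rewrite -/E /condprob => ->.
    by rewrite -/(condprob _ _ _) -/q indicI /=; ring.
  rewrite setIC -(c.2 _ mB) integral_mkcondr; apply: eq_integral => w _.
  by rewrite patchE [\1_(_ @^-1` C) w]indicE; case: ifP => _; rewrite ?mul1r ?mul0r.
have mDq : measurable_fun setT (fun v : TZ * TL => \1_D (S v) - q v.2).
  apply: measurable_funB; first exact: measurableT_comp.
  exact: measurableT_comp.
have := cond_centered_comp_eq0 mW mDq cW.
by apply: filterS => w /eqP; rewrite subr_eq0 => /eqP.
Qed.
End pair_conditioning.

(** * Bounds and integrability through conditional expectations *)

Section conditional_bounds.
Context d (T : measurableType d) (R : realType) (P : probability T R).
Context d' (T' : measurableType d') (V : T -> T').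
Hypothesis mV : measurable_fun setT V.

Lemma cond_centered_comp_norm_le (X Y : T -> R) (k h : T' -> R) :
  measurable_fun setT k -> measurable_fun setT h ->
  P.-integrable setT (EFin \o X) -> P.-integrable setT (EFin \o Y) ->
  cond_centered P V (fun w => X w - k (V w)) ->
  cond_centered P V (fun w => Y w - h (V w)) ->
  {ae P, forall w, `|X w| <= Y w} -> {ae P, forall w, `|k (V w)| <= h (V w)}.
Proof.
move=> mk mh iX iY cX cY XY.
have mX := integrable_measurable iX; have mY := integrable_measurable iY.
have mkV : measurable_fun setT (fun w => k (V w)) by exact: measurableT_comp.
have mhV : measurable_fun setT (fun w => h (V w)) by exact: measurableT_comp.
have upper : {ae P, forall w, 0 <= h (V w) - k (V w)}.
  apply: (cond_centered_comp_ge0 mV (k := fun v => h v - k v)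
    (X := fun w => Y w - X w)).
  - exact: measurable_funB.
  - exact: (integrableB measurableT iY iX).
  - apply: (cond_centered_ae mV _ _ (cond_centeredB mV cY cX)).
      by apply: measurable_funB; exact: measurable_funB.
    by apply: aeW => w; ring.
  - apply: filterS XY => w XYw; rewrite subr_ge0.
    by apply: le_trans XYw; exact: ler_norm.
have lower : {ae P, forall w, 0 <= h (V w) + k (V w)}.
  apply: (cond_centered_comp_ge0 mV (k := fun v => h v + k v)
    (X := fun w => Y w + X w)).
  - exact: measurable_funD.
  - exact: (integrableD measurableT iY iX).
  - apply: (cond_centered_ae mV _ _ (cond_centeredD mV cY cX)).
      by apply: measurable_funB; exact: measurable_funD.
    by apply: aeW => w; ring.
  - by apply: filterS XY => w; rewrite ler_norml => /andP[XYw _]; lra.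
by apply: filterS2 upper lower => w up lo; rewrite ler_norml; lra.
Qed.

Lemma condexp_norm_le (X : T -> R) (M : R) : measurable_fun setT X ->
  {ae P, forall w, `|X w| <= M} -> {ae P, forall w, `|condexp P V X (V w)| <= M}.
Proof.
move=> mX XM; have iX := ae_bounded_integrable mX XM.
have iM : P.-integrable setT (EFin \o (cst M : T -> R)).
  exact: finite_measure_integrable_cst.
apply: (cond_centered_comp_norm_le (h := cst M) _ _ iX iM) => //.
- exact: measurable_condexp.
- exact: cond_centered_condexp.
- split=> [|B mB].
    by rewrite (_ : EFin \o _ = cst 0%E); [exact: integrable0|
      apply/funext => w; rewrite /= subrr].
  by rewrite integral0_eq// => w _; rewrite /= subrr.
Qed.

Lemma ae_le_integral (D : set T) (X X' : T -> R) : measurable D ->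
  P.-integrable setT (EFin \o X) -> P.-integrable setT (EFin \o X') ->
  {ae P, forall w, X w <= X' w} ->
  (\int[P]_(w in D) (X w)%:E <= \int[P]_(w in D) (X' w)%:E)%E.
Proof.
move=> mD iX iX' XX'.
have iXD : P.-integrable D (EFin \o X) by exact: integrableS iX.
have iXD' : P.-integrable D (EFin \o X') by exact: integrableS iX'.
have mB : measurable_fun D (EFin \o (fun w => X' w - X w)).
  exact: measurable_int (integrableB mD iXD' iXD).
rewrite -sube_ge0 ?integrable_fin_num// -integralB//.
rewrite (_ : integral _ _ _ = \int[P]_(w in D) `|X' w - X w|%:E)%E.
  by apply: integral_ge0 => w _; rewrite lee_fin.
apply: ae_eq_integral => //.
- by apply/measurable_EFinP/measurableT_comp => //; exact/measurable_EFinP.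
- by apply: filterS XX' => w le _ /=; rewrite ger0_norm ?subr_ge0// EFinB.
Qed.

(** Since E[X | V] >= c, the integral of c |g(V)| is at most that of |g(V)| X. The comparison is one
    of nonnegative integrals, so it does not presuppose that g(V) is integrable. With [X] the
    indicator of a treatment arm this is the overlap argument. *)
Lemma integrable_comp_lower_bound (X : T -> R) (k g : T' -> R) (c : R) : 0 < c ->
  measurable_fun setT k -> measurable_fun setT g ->
  (forall w, 0 <= X w) -> P.-integrable setT (EFin \o X) ->
  cond_centered P V (fun w => X w - k (V w)) ->
  {ae P, forall w, c <= k (V w)} ->
  P.-integrable setT (EFin \o (fun w => g (V w) * X w)) ->
  P.-integrable setT (EFin \o (fun w => g (V w))).
Proof.
move=> c0 mk mg X0 iX cX ck igX.
have mX := integrable_measurable iX.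
have mgV : measurable_fun setT (fun w => g (V w)) by exact: measurableT_comp.
have le : (\int[P]_w ((`|g (V w)|)%:E * c%:E) <=
           \int[P]_w ((`|g (V w)|)%:E * (X w)%:E))%E.
  apply: (ge0_le_integral_comp mV (k := fun v => `|g v|%:E) (X := cst c%:E)) => //.
  - by move=> w; rewrite lee_fin ltW.
  - exact/measurable_EFinP.
  - by apply/measurable_EFinP; exact: measurableT_comp.
  - move=> B mB; have mVB := measurable_preimageT mV mB.
    have ikV : P.-integrable setT (EFin \o (fun w => k (V w))).
      have := integrableB measurableT iX cX.1.
      by apply: eq_integrable => // w _ /=; rewrite -EFinB; congr EFin; ring.
    have -> : (\int[P]_(w in V @^-1` B) (X w)%:E =
               \int[P]_(w in V @^-1` B) (k (V w))%:E)%E.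
      rewrite -[RHS]add0e -(cX.2 _ mB) -integralD//.
      + by apply: eq_integral => w _; rewrite -EFinD; congr EFin; ring.
      + by apply: integrableS cX.1.
      + by apply: integrableS ikV.
    apply: (ae_le_integral (X := cst c)) => //.
    exact: finite_measure_integrable_cst.
have cgi : P.-integrable setT (EFin \o (fun w => c * g (V w))).
  apply/integrableP; split; first by apply/measurable_EFinP; exact: measurable_funM.
  move/integrableP : igX => [_]; apply: le_lt_trans; move: le; congr (_ <= _)%E.
  - apply: eq_integral => w _ /=; rewrite -EFinM normrM (gtr0_norm c0).
    by rewrite mulrC.
  - by apply: eq_integral => w _ /=; rewrite -EFinM normrM (ger0_norm (X0 w)).
have := integrableZl measurableT c^-1 cgi.
by apply: eq_integrable => // w _ /=; rewrite -EFinM mulKf ?gt_eqF.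
Qed.
End conditional_bounds.

Lemma measurable_funV d (T : measurableType d) (R : realType) (X : T -> R) :
  measurable_fun setT X -> measurable_fun setT (fun w => (X w)^-1).
Proof.
(* Writing 1/x as x (x^2)^(-1) moves the inversion to a nonnegative base, where it is a real power.
   At x = 0 both sides are 0, because [0^-1 = 0]. *)
move=> mX; rewrite (_ : (fun w => _) = (fun w => X w * (X w ^+ 2) `^ (-1))).
  apply: measurable_funM => //.
  exact: (measurableT_comp (measurable_powR (-1)) (measurable_funX 2 mX)).
apply/funext => w; rewrite powR_inv1 ?sqr_ge0//.
have [->|x0] := eqVneq (X w) 0; first by rewrite invr0 mul0r.
by rewrite expr2 invfM mulVKf.
Qed.

(** * Comparing second moments without square integrability *)

Section noise_comparison.
Context d (T : measurableType d) (R : realType) (P : probability T R).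
Context d1 (T1 : measurableType d1) d2 (T2 : measurableType d2).
Variables (W : T -> T1) (q : T1 -> T2) (e : T -> R).
Hypotheses (mW : measurable_fun setT W) (mq : measurable_fun setT q).
Hypothesis ce : cond_centered P W e.

Let me : measurable_fun setT e. Proof. exact: integrable_measurable ce.1. Qed.

(** The products [h g] and [r] are bounded, so the cross term is a bounded function of [W] times
    [e]: integrable with mean zero. The first square is bounded by 1, and only the noise square
    needs an integrability hypothesis. *)
Let expand_square (g h : T2 -> R) (r : T1 -> R) (M : R) :
  measurable_fun setT g -> measurable_fun setT h -> measurable_fun setT r ->
  (forall v, 0 <= h v) -> (forall v, h v * g v ^+ 2 <= 1) ->
  (forall v, `|h v * g v| <= 1) ->
  {ae P, forall w, `|r (W w)| <= M} ->
  P.-integrable setT (EFin \o (fun w => h (q (W w)) * (r (W w) * e w) ^+ 2)) ->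
  (\int[P]_w (h (q (W w)) * (g (q (W w)) + r (W w) * e w) ^+ 2)%:E =
   \int[P]_w (h (q (W w)) * g (q (W w)) ^+ 2)%:E +
   \int[P]_w (h (q (W w)) * (r (W w) * e w) ^+ 2)%:E)%E.
Proof.
move=> mg mh mr h0 hg2 hg rM i2.
have mqW : measurable_fun setT (fun w => q (W w)) by exact: measurableT_comp.
have mk : measurable_fun setT (fun v => 2 * (h (q v) * g (q v)) * r v).
  by do 2! apply: measurable_funM => //; apply: measurable_funM; exact: measurableT_comp.
have cross : cond_centered P W (fun w => 2 * (h (q (W w)) * g (q (W w))) * r (W w) * e w).
  apply: (cond_centered_bounded_mul mW (M := 2 * M) mk) => //.
  apply: filterS rM => w rMw; rewrite 2!normrM (ger0_norm (ltW (ltr0Sn _ _))).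
  rewrite -mulrA ler_pM2l//.
  by rewrite -[M]mul1r ler_pM.
have i1 : P.-integrable setT (EFin \o (fun w => h (q (W w)) * g (q (W w)) ^+ 2)).
  apply: (@ae_bounded_integrable _ _ _ _ _ 1).
    apply: (measurableT_comp _ mqW (f := fun v => h v * g v ^+ 2)).
    by apply: measurable_funM => //; exact: measurable_funX.
  by apply: aeW => w; rewrite ger0_norm ?hg2// mulr_ge0// sqr_ge0.
rewrite -[X in (X + _)%E]adde0 -(cond_centered_integral cross).
rewrite -integralD//; last exact: cross.1.
rewrite -integralD//; last exact: (integrableD measurableT i1 cross.1).
by apply: eq_integral => w _; rewrite -!EFinD; congr EFin; ring.
Qed.

(* The weight 1 / (1 + g^2) makes all the terms of the expanded squares
   integrable even when g is not square integrable. *)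
Lemma le_integral_square_noise (g : T2 -> R) (r1 r2 : T1 -> R) (M : R) :
  measurable_fun setT g -> measurable_fun setT r1 -> measurable_fun setT r2 ->
  {ae P, forall w, `|r1 (W w)| <= M} -> {ae P, forall w, `|r2 (W w)| <= M} ->
  (forall k : T2 -> R, measurable_fun setT k -> (forall v, 0 <= k v) ->
    (\int[P]_w (k (q (W w)) * (r1 (W w) * e w) ^+ 2)%:E <=
     \int[P]_w (k (q (W w)) * (r2 (W w) * e w) ^+ 2)%:E)%E) ->
  (\int[P]_w ((g (q (W w)) + r1 (W w) * e w) ^+ 2)%:E <=
   \int[P]_w ((g (q (W w)) + r2 (W w) * e w) ^+ 2)%:E)%E.
Proof.
move=> mg mr1 mr2 r1M r2M r12.
have mqW : measurable_fun setT (fun w => q (W w)) by exact: measurableT_comp.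
pose K v := (1 + g v ^+ 2)^-1.
have K1 v : 0 < 1 + g v ^+ 2 by rewrite ltr_pwDl// sqr_ge0.
have K0 v : 0 < K v by rewrite invr_gt0.
have mK : measurable_fun setT K.
  by apply/measurable_funV/measurable_funD => //; exact: measurable_funX.
have mphi (r : T1 -> R) : measurable_fun setT r ->
    measurable_fun setT (fun w => (g (q (W w)) + r (W w) * e w) ^+ 2).
  move=> mr; apply: measurable_funX; apply: measurable_funD.
    exact: measurableT_comp.
  by apply: measurable_funM => //; exact: measurableT_comp.
have mKphi (r : T1 -> R) : measurable_fun setT r ->
    measurable_fun setT (fun w => K (q (W w)) * (g (q (W w)) + r (W w) * e w) ^+ 2).
  move=> mr; apply: measurable_funM; last exact: mphi.
  exact: measurableT_comp.
have weighted (r : T1 -> R) : (\int[P]_w ((g (q (W w)) + r (W w) * e w) ^+ 2)%:E =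
    \int[P]_w ((1 + g (q (W w)) ^+ 2)%:E *
      (K (q (W w)) * (g (q (W w)) + r (W w) * e w) ^+ 2)%:E))%E.
  by apply: eq_integral => w _; rewrite -EFinM mulrA mulfV ?mul1r// gt_eqF.
rewrite !weighted.
(* The unbounded factor 1 + g^2 depends on q(W) alone, so it suffices to compare the squares
   weighted by [K] over each event of q(W). *)
apply: (ge0_le_integral_comp mqW (k := fun v => (1 + g v ^+ 2)%:E)
  (X := EFin \o (fun w => K (q (W w)) * (g (q (W w)) + r1 (W w) * e w) ^+ 2))
  (X' := EFin \o (fun w => K (q (W w)) * (g (q (W w)) + r2 (W w) * e w) ^+ 2))).
- exact/measurable_EFinP/mKphi.
- by move=> w; rewrite lee_fin mulr_ge0 ?sqr_ge0 ?ltW.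
- exact/measurable_EFinP/mKphi.
- by move=> w; rewrite lee_fin mulr_ge0 ?sqr_ge0 ?ltW.
- by apply/measurable_EFinP; apply: measurable_funD => //; exact: measurable_funX.
- by move=> v; rewrite lee_fin ltW.
move=> B mB; pose h v := K v * \1_B v.
have mh : measurable_fun setT h by exact: measurable_funM.
have h0 v : 0 <= h v by rewrite /h indicE; apply: mulr_ge0 => //; exact: ltW.
have hK v : h v <= K v.
  by rewrite /h indicE; case: (v \in B); rewrite ?mulr1// mulr0 ltW.
have hg2 v : h v * g v ^+ 2 <= 1.
  apply: (@le_trans _ _ (K v * g v ^+ 2)); first by rewrite ler_wpM2r ?sqr_ge0.
  by rewrite /K mulrC ler_pdivrMr// mul1r lerDr.
have hg v : `|h v * g v| <= 1.
  rewrite normrM (ger0_norm (h0 v)).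
  apply: (@le_trans _ _ (K v * `|g v|)); first by rewrite ler_wpM2r.
  rewrite /K mulrC ler_pdivrMr// mul1r -[g v ^+ 2]real_normK ?num_real//.
  have := sqr_ge0 (`|g v| - 1); have := normr_ge0 (g v); nra.
have restrict (r : T1 -> R) : (\int[P]_(w in (fun w => q (W w)) @^-1` B)
      (EFin \o (fun w => K (q (W w)) * (g (q (W w)) + r (W w) * e w) ^+ 2)%R) w =
    \int[P]_w (h (q (W w)) * (g (q (W w)) + r (W w) * e w) ^+ 2)%:E)%E.
  rewrite integral_mkcond; apply: eq_integral => w _.
  rewrite patchE -[w \in _]/(q (W w) \in B) /h indicE; case: ifP => _ /=.
    by rewrite mulr1.
  by rewrite mulr0 mul0r.
rewrite !restrict.
have mhr (r : T1 -> R) : measurable_fun setT r ->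
    measurable_fun setT (fun w => h (q (W w)) * (r (W w) * e w) ^+ 2).
  move=> mr; apply: measurable_funM; first exact: measurableT_comp.
  by apply: measurable_funX; apply: measurable_funM => //; exact: measurableT_comp.
have hx0 w x : 0 <= h (q (W w)) * x ^+ 2 by apply: mulr_ge0 => //; exact: sqr_ge0.
set J2 := (X in (_ <= X)%E).
(* An infinite right-hand side leaves nothing to prove. A finite one makes the weighted noise square
   of [r2] integrable, and by the comparison hypothesis that of [r1] as well. *)
have [J2oo|J2fin] := leP +oo%E J2; first exact: le_trans (leey _) J2oo.
have i2 : P.-integrable setT (EFin \o (fun w => h (q (W w)) * (r2 (W w) * e w) ^+ 2)).
  have iphi : P.-integrable setT
      (EFin \o (fun w => h (q (W w)) * (g (q (W w)) + r2 (W w) * e w) ^+ 2)).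
    apply/integrableP; split.
      apply/measurable_EFinP/measurable_funM; first exact: measurableT_comp.
      exact: mphi.
    move: J2fin; congr (_ < _)%E; apply: eq_integral => w _ /=.
    by rewrite ger0_norm.
  have i1 : P.-integrable setT (EFin \o (cst 1 : T -> R)).
    exact: finite_measure_integrable_cst.
  have ib := integrableD measurableT (integrableZl measurableT 2 iphi)
    (integrableZl measurableT 2 i1).
  apply: le_integrable ib => //; first exact/measurable_EFinP/mhr.
  move=> w _ /=; rewrite lee_fin [leLHS]ger0_norm ?hx0//.
  apply: le_trans (ler_norm _).
  (* With x = r2 e one has 2 (g + x)^2 + 2 g^2 - x^2 = (x + 2 g)^2 >= 0, and h g^2 <= 1; this is
     where the dominating function 2 h (g + x)^2 + 2 comes from. *)
  have := hg2 (q (W w)).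
  by have := mulr_ge0 (h0 (q (W w))) (sqr_ge0 (r2 (W w) * e w + 2 * g (q (W w)))); nra.
have i1 : P.-integrable setT (EFin \o (fun w => h (q (W w)) * (r1 (W w) * e w) ^+ 2)).
  apply/integrableP; split; first exact/measurable_EFinP/mhr.
  move/integrableP : i2 => [_]; apply: le_lt_trans; move: (r12 h mh h0).
  by congr (_ <= _)%E; apply: eq_integral => w _ /=; rewrite ger0_norm.
rewrite (expand_square mg mh mr1 h0 hg2 hg r1M i1) /J2.
rewrite (expand_square mg mh mr2 h0 hg2 hg r2M i2).
by rewrite leeD2l// r12.
Qed.
End noise_comparison.

(** * Weighting functions *)

Section weighting_functions.
Context d (T : measurableType d) (R : realType) (P : probability T R).
Context dZ (TZ : measurableType dZ) dL (TL : measurableType dL).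
Variables (Z : T -> TZ) (A : T -> bool) (L : T -> TL).
Hypotheses (mZ : measurable_fun setT Z) (mA : measurable_fun setT A).
Hypothesis mL : measurable_fun setT L.

Local Notation A01 := (fun w => (A w)%:R : R).
Local Notation W := (fun w => (Z w, L w)).
Local Notation delta := (condexp P L A01).
Local Notation prop := (propensity P Z A L).

Let mE : measurable (A @^-1` [set true]).
Proof. exact: (measurable_preimageT mA). Qed.

Let indicA w : \1_(A @^-1` [set true]) w = (A w)%:R :> R.
Proof.
by rewrite indicE; congr (_%:R); congr nat_of_bool; apply/idP/idP; rewrite inE.
Qed.

Lemma measurable_treatment : measurable_fun setT A01.
Proof.
rewrite (_ : A01 = \1_(A @^-1` [set true])); first exact: measurable_indic.
by apply/funext => w; rewrite indicA.
Qed.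

Lemma measurable_pair : measurable_fun setT W.
Proof. exact: measurable_fun_pair. Qed.

Lemma integrable_treatment : P.-integrable setT (EFin \o A01).
Proof.
apply: (@ae_bounded_integrable _ _ _ _ _ 1); first exact: measurable_treatment.
by apply: aeW => w; case: (A w); rewrite ?normr1 ?normr0.
Qed.

Lemma measurable_propensity : measurable_fun setT prop.
Proof.
apply: (measurable_condexp measurable_pair); exact: integrable_indicator.
Qed.

Lemma cond_centered_propensity :
  cond_centered P W (fun w => (A w)%:R - prop (Z w, L w)).
Proof.
have := cond_centered_condexp measurable_pair
  (integrable_indicator P mE).
apply: (cond_centered_ae measurable_pair).
  apply: measurable_funB; first exact: measurable_treatment.
  exact: (measurableT_comp measurable_propensity measurable_pair).
by apply: aeW => w; rewrite indicA.
Qed.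

Lemma cond_centered_of_pair (X : T -> R) : cond_centered P W X -> cond_centered P L X.
Proof. by move=> [iX X0]; apply: (cond_centered_tower (W := W) (q := snd)). Qed.

Lemma propensity_itv01 : {ae P, forall w, 0 <= prop (Z w, L w) <= 1}.
Proof. by apply: (condprob_itv01 P measurable_pair). Qed.

Lemma cond_centered_delta : cond_centered P L (fun w => (A w)%:R - delta (L w)).
Proof. exact: (cond_centered_condexp mL integrable_treatment). Qed.

Lemma measurable_delta : measurable_fun setT delta.
Proof. exact: (measurable_condexp mL integrable_treatment). Qed.

Lemma delta_itv01 : {ae P, forall w, 0 <= delta (L w) <= 1}.
Proof.
have := condprob_itv01 P mL mE; rewrite /condprob.
by rewrite (_ : \1_(A @^-1` [set true]) = A01)//; apply/funext => w; rewrite indicA.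
Qed.

Lemma treatment_deviation_le : {ae P, forall w, `|(A w)%:R - delta (L w)| <= 1}.
Proof.
apply: filterS delta_itv01 => w /andP[d0 d1].
by rewrite ler_norml; case: (A w) => /=; lra.
Qed.

Section one_weight.
Variables (wt : TZ * TL -> R) (M : R).
Hypothesis mwt : measurable_fun setT wt.
Hypothesis wtM : {ae P, forall w, `|wt (Z w, L w)| <= M}.

Local Notation rho := (condexp P L (fun w => wt (Z w, L w))).
Local Notation kappa := (condcov P L A01 (fun w => wt (Z w, L w))).

Let mwtW : measurable_fun setT (fun w => wt (Z w, L w)).
Proof. exact: (measurableT_comp mwt measurable_pair). Qed.

Let iwt : P.-integrable setT (EFin \o (fun w => wt (Z w, L w))).
Proof. exact: ae_bounded_integrable mwtW wtM. Qed.

Lemma measurable_rho : measurable_fun setT rho.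
Proof. exact: (measurable_condexp mL iwt). Qed.

Let mdev : measurable_fun setT (fun w => wt (Z w, L w) - rho (L w)).
Proof. by apply: measurable_funB => //; exact: (measurableT_comp measurable_rho mL). Qed.

Lemma weight_deviation_le :
  {ae P, forall w, `|wt (Z w, L w) - rho (L w)| <= 2 * M}.
Proof.
apply: filterS2 wtM (condexp_norm_le mL mwtW wtM) => w wM rM.
by rewrite (le_trans (ler_normB _ _))//; lra.
Qed.

Lemma cond_centered_weight : cond_centered P L (fun w => wt (Z w, L w) - rho (L w)).
Proof. exact: (cond_centered_condexp mL iwt). Qed.

Lemma cond_centered_condcov : measurable_fun setT kappa /\
  cond_centered P L (fun w =>
    ((A w)%:R - delta (L w)) * (wt (Z w, L w) - rho (L w)) - kappa (L w)).
Proof.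
have mAd : measurable_fun setT (fun w => (A w)%:R - delta (L w)).
  exact: integrable_measurable cond_centered_delta.1.
have iprod : P.-integrable setT
    (EFin \o (fun w => ((A w)%:R - delta (L w)) * (wt (Z w, L w) - rho (L w)))).
  exact: (ae_bounded_integrableM mAd treatment_deviation_le cond_centered_weight.1).
split; first exact: (measurable_condexp mL iprod).
exact: (cond_centered_condexp mL iprod).
Qed.

(** Replacing A - delta by A adds delta(L) (wt - rho), a bounded function of L times a centered
    variable. The uncentered form makes the factor A visible, on which the bounds on [kappa]
    depend. *)
Lemma cond_centered_kappa : measurable_fun setT kappa /\
  cond_centered P L (fun w => (A w)%:R * (wt (Z w, L w) - rho (L w)) - kappa (L w)).
Proof.
have [mk ck] := cond_centered_condcov; split=> //.
have d1 : {ae P, forall w, `|delta (L w)| <= 1}.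
  by apply: filterS delta_itv01 => w /andP[d0 d1]; rewrite ler_norml; lra.
have := cond_centeredD mL ck
  (cond_centered_bounded_mul mL measurable_delta d1 cond_centered_weight).
apply: (cond_centered_ae mL).
  apply: measurable_funB.
    by apply: measurable_funM => //; exact: measurable_treatment.
  exact: (measurableT_comp mk mL).
by apply: aeW => w; ring.
Qed.

(** The deviation of the weight is at most 2 M in absolute value, and [kappa] is the conditional
    mean of A (wt - rho) as well as minus that of (1 - A) (wt - rho). The factors A and 1 - A have
    conditional means delta and 1 - delta. *)
Lemma kappa_le : {ae P, forall w, `|kappa (L w)| <= 2 * M * delta (L w)} /\
  {ae P, forall w, `|kappa (L w)| <= 2 * M * (1 - delta (L w))}.
Proof.
have [mk ck] := cond_centered_kappa.
have cd := cond_centered_bounded_mul mL (k := cst (2 * M)) (M := `|2 * M|)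
  (measurable_cst _) (aeW _ (fun w => lexx _)) cond_centered_delta.
have i1 : P.-integrable setT (EFin \o (cst 1 : T -> R)).
  exact: finite_measure_integrable_cst.
have bounded (X : T -> R) : measurable_fun setT X -> (forall w, `|X w| <= 1) ->
    P.-integrable setT (EFin \o (fun w => X w * (wt (Z w, L w) - rho (L w)))) /\
    P.-integrable setT (EFin \o (fun w => 2 * M * X w)).
  move=> mX X1; have iX : P.-integrable setT (EFin \o X).
    by apply: ae_bounded_integrable mX (aeW _ X1).
  split; last exact: (integrableZl measurableT (2 * M) iX).
  exact: (ae_bounded_integrableM mX (aeW _ X1) cond_centered_weight.1).
split.
- have [] := bounded _ measurable_treatment.
    by move=> w; case: (A w); rewrite ?normr1 ?normr0.
  move=> iX iY; apply: (cond_centered_comp_norm_le mL mk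
    (h := fun v => 2 * M * delta v) _ iX iY ck).
  + by apply: measurable_funM => //; exact: measurable_delta.
  + apply: (cond_centered_ae mL _ _ cd).
      apply: measurable_funB; first exact: (integrable_measurable iY).
      apply: measurable_funM => //; exact: (measurableT_comp measurable_delta mL).
    by apply: aeW => w /=; ring.
  + apply: filterS weight_deviation_le => w wM; rewrite normrM mulrC.
    by rewrite (ger0_norm (ler0n _ _)) ler_wpM2r.
- have [] := bounded (fun w => 1 - (A w)%:R).
  + by apply: measurable_funB => //; exact: measurable_treatment.
  + by move=> w; case: (A w); rewrite ?subrr ?subr0 ?normr1 ?normr0.
  move=> iX iY; have {}mk : measurable_fun setT (fun v => - kappa v) by exact: measurable_funN.
  suff : {ae P, forall w, `|- kappa (L w)| <= 2 * M * (1 - delta (L w))}.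
    by apply: filterS => w; rewrite normrN.
  apply: (cond_centered_comp_norm_le mL mk
    (h := fun v => 2 * M * (1 - delta v)) _ iX iY).
  + apply: measurable_funM => //; apply: measurable_funB => //.
    exact: measurable_delta.
  + apply: (cond_centered_ae mL _ _ (cond_centeredB mL cond_centered_weight ck)).
      apply: measurable_funB; first exact: (integrable_measurable iX).
      exact: (measurableT_comp mk mL).
    by apply: aeW => w /=; ring.
  + apply: (cond_centered_ae mL _ _ (cond_centeredN mL cd)).
      apply: measurable_funB; first exact: (integrable_measurable iY).
      apply: measurable_funM => //; apply: measurable_funB => //.
      exact: (measurableT_comp measurable_delta mL).
    by apply: aeW => w /=; ring.
  + apply: filterS weight_deviation_le => w wM; rewrite normrM mulrC.
    rewrite (ger0_norm (_ : 0 <= 1 - _)) ?ler_wpM2r//;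
      by case: (A w); rewrite ?subrr ?subr0.
Qed.

(** The deviation wt - rho is a bounded function of [(Z, L)], so [A] may be replaced by its
    conditional mean given that pair. This makes [kappa] a covariance between two functions of
    [(Z, L)]. *)
Lemma cond_centered_propensity_weight :
  cond_centered P L (fun w => prop (Z w, L w) * (wt (Z w, L w) - rho (L w)) - kappa (L w)).
Proof.
have [mk ck] := cond_centered_kappa.
have mdevW : measurable_fun setT (fun v : TZ * TL => wt v - rho v.2).
  by apply: measurable_funB => //; exact: (measurableT_comp measurable_rho).
have cA := cond_centered_of_pair (cond_centered_bounded_mul measurable_pair
  mdevW weight_deviation_le cond_centered_propensity).
apply: (cond_centered_ae mL _ _ (cond_centeredB mL ck cA)).
  apply: measurable_funB; last exact: (measurableT_comp mk mL).
  apply: measurable_funM => //.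
  exact: (measurableT_comp measurable_propensity measurable_pair).
by apply: aeW => w /=; ring.
Qed.

Lemma cond_centered_propensity_deviation :
  cond_centered P L (fun w =>
    (prop (Z w, L w) - delta (L w)) * (wt (Z w, L w) - rho (L w)) - kappa (L w)).
Proof.
have [mk _] := cond_centered_kappa.
have d1 : {ae P, forall w, `|delta (L w)| <= 1}.
  by apply: filterS delta_itv01 => w /andP[d0 d1]; rewrite ler_norml; lra.
apply: (cond_centered_ae mL _ _ (cond_centeredB mL cond_centered_propensity_weight
  (cond_centered_bounded_mul mL measurable_delta d1 cond_centered_weight))).
  apply: measurable_funB; last exact: (measurableT_comp mk mL).
  apply: measurable_funM => //; apply: measurable_funB.
    exact: (measurableT_comp measurable_propensity measurable_pair).
  exact: (measurableT_comp measurable_delta mL).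
by apply: aeW => w /=; ring.
Qed.

End one_weight.

Lemma condexp_propensity_ae :
  {ae P, forall w, condexp P L (fun w => prop (Z w, L w)) (L w) = delta (L w)}.
Proof.
have pM : {ae P, forall w, `|prop (Z w, L w)| <= 1}.
  by apply: filterS propensity_itv01 => w /andP[p0 p1]; rewrite ler_norml; lra.
have mpW : measurable_fun setT (fun w => prop (Z w, L w)).
  exact: (measurableT_comp measurable_propensity measurable_pair).
apply: (condexp_ae_eq mL measurable_delta (ae_bounded_integrable mpW pM)).
have cp := cond_centered_of_pair cond_centered_propensity.
apply: (cond_centered_ae mL _ _ (cond_centeredB mL cond_centered_delta cp)).
  by apply: measurable_funB => //; exact: (measurableT_comp measurable_delta mL).
by apply: aeW => w /=; ring.
Qed.

End weighting_functions.

(** * Regularity of the propensity and minimality of its weight ratio *)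

Section regular_weighting_functions.
Context d (T : measurableType d) (R : realType) (P : probability T R).
Context dZ (TZ : measurableType dZ) dL (TL : measurableType dL).
Variables (Z : T -> TZ) (A : T -> bool) (L : T -> TL).
Hypotheses (mZ : measurable_fun setT Z) (mA : measurable_fun setT A).
Hypothesis mL : measurable_fun setT L.

Local Notation A01 := (fun w => (A w)%:R : R).
Local Notation W := (fun w => (Z w, L w)).
Local Notation delta := (condexp P L A01).
Local Notation prop := (propensity P Z A L).
Local Notation rho wt := (condexp P L (fun w => wt (Z w, L w))).
Local Notation kappa wt := (condcov P L A01 (fun w => wt (Z w, L w))).

Lemma regular_weight_bounds (wt : TZ * TL -> R) : regular_weight P Z A L wt ->
  exists M e0 : R, [/\ 0 < M, 0 < e0, measurable_fun setT wt,
    {ae P, forall w, `|wt (Z w, L w)| <= M} &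
    {ae P, forall w, e0 <= `|kappa wt (L w)|}].
Proof.
move=> [mwt [M wtM] [e0 e00 ke0]]; exists (`|M| + 1), e0; split=> //.
by apply: filterS wtM => w wM; rewrite (le_trans wM)// (le_trans (ler_norm _))// lerDl.
Qed.

(** Overlap follows from regularity: [e0] is at most |kappa|, which is at most both 2 M delta and 2
    M (1 - delta). *)
Lemma regular_delta_bounds (wt : TZ * TL -> R) : regular_weight P Z A L wt ->
  exists2 c : R, 0 < c & {ae P, forall w, c <= delta (L w) <= 1 - c}.
Proof.
move=> /regular_weight_bounds[M [e0 [M0 e00 mwt wtM ke0]]].
have [k1 k2] := kappa_le mZ mA mL mwt wtM.
exists (e0 / (2 * M)); first by rewrite divr_gt0// mulr_gt0.
apply: filterS3 k1 k2 ke0 => w kd kd' ek.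
rewrite ler_pdivrMr ?mulr_gt0// lerBrDr -lerBrDl ler_pdivrMr ?mulr_gt0//.
by rewrite [_ * (2 * M)]mulrC (le_trans ek)//= mulrC (le_trans ek).
Qed.

Lemma propensity_variance_lower_bound (wt : TZ * TL -> R) (M e0 : R) :
  0 < M -> 0 < e0 -> measurable_fun setT wt ->
  {ae P, forall w, `|wt (Z w, L w)| <= M} ->
  {ae P, forall w, e0 <= `|kappa wt (L w)|} ->
  {ae P, forall w, e0 ^+ 2 / (4 * M ^+ 2) <= kappa prop (L w)}.
Proof.
have le3 : 2 + 1 <= 3 :> R by lra.
move=> M0 e00 mwt wtM ke0.
have mp := measurable_propensity P mZ mA mL.
have pM : {ae P, forall w, `|prop (Z w, L w)| <= 1}.
  by apply: filterS (propensity_itv01 P mZ mA mL) => w /andP[p0 p1]; rewrite ler_norml; lra.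
have mpW : measurable_fun setT (fun w => prop (Z w, L w)).
  exact: (measurableT_comp mp (measurable_pair mZ mL)).
have md := measurable_delta P mA mL.
have mpd : measurable_fun setT (fun w => prop (Z w, L w) - delta (L w)).
  by apply: measurable_funB => //; exact: (measurableT_comp md mL).
have [mk _] := cond_centered_kappa mZ mA mL mwt wtM.
have [mkp _] := cond_centered_kappa mZ mA mL mp pM.
have [kM _] := kappa_le mZ mA mL mwt wtM.
have [kpM _] := kappa_le mZ mA mL mp pM.
have cwt := cond_centered_propensity_deviation mZ mA mL mwt wtM.
have cp : cond_centered P L
    (fun w => (prop (Z w, L w) - delta (L w)) ^+ 2 - kappa prop (L w)).
  apply: (cond_centered_ae mL _ _ (cond_centered_propensity_deviation mZ mA mL mp pM)).
    apply: measurable_funB; first exact: measurable_funX.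
    exact: (measurableT_comp mkp mL).
  apply: filterS (condexp_propensity_ae P mZ mA mL) => w ->.
  by rewrite expr2.
(* This minimizes Var(p | L) - 2 t kappa + 4 M^2 t^2 over t, where 4 M^2 = (2 M)^2 bounds (wt -
   rho)^2 and stands for the conditional variance of the weight. *)
pose t v := kappa wt v / (4 * M ^+ 2).
have mt : measurable_fun setT t by exact: measurable_funM.
have M2 : 0 < 4 * M ^+ 2 by rewrite mulr_gt0// exprn_gt0.
have tM : {ae P, forall w, `|2 * t (L w)| <= M^-1}.
  apply: filterS2 kM (delta_itv01 P mA mL) => w kw /andP[d0 d1].
  rewrite /t !normrM normfV (gtr0_norm (ltr0Sn _ _)) (gtr0_norm M2).
  rewrite mulrA ler_pdivrMr//.
  have -> : M^-1 * (4 * M ^+ 2) = 2 * (2 * M) by field; rewrite gt_eqF.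
  rewrite ler_pM2l// (le_trans kw)// ler_piMr// mulr_ge0// ltW//.
(* Conditional Cauchy-Schwarz, from E[(p - delta - t (wt - rho))^2 | L] >= 0. *)
have ct := cond_centered_bounded_mul mL (k := fun v => 2 * t v) _ tM cwt.
have {}ct := cond_centeredB mL cp (ct (measurable_funM (measurable_cst _) mt)).
have : {ae P, forall w, 0 <= kappa prop (L w) - kappa wt (L w) ^+ 2 / (4 * M ^+ 2)}.
  pose X w := (prop (Z w, L w) - delta (L w)) ^+ 2 -
    2 * t (L w) * ((prop (Z w, L w) - delta (L w)) * (wt (Z w, L w) - rho wt (L w))) +
    t (L w) ^+ 2 * (4 * M ^+ 2).
  pose k v := kappa prop v - kappa wt v ^+ 2 / (4 * M ^+ 2).
  have mk' : measurable_fun setT k.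
    apply: measurable_funB => //; apply: measurable_funM => //.
    exact: measurable_funX.
  have mtL : measurable_fun setT (fun w => t (L w)) by exact: (measurableT_comp mt mL).
  have mX : measurable_fun setT X.
    apply: measurable_funD.
      apply: measurable_funB; first exact: measurable_funX.
      apply: measurable_funM; first exact: measurable_funM.
      apply: measurable_funM => //; apply: measurable_funB.
        exact: (measurableT_comp mwt (measurable_pair mZ mL)).
      exact: (measurableT_comp (measurable_rho mZ mL mwt wtM) mL).
    by apply: measurable_funM => //; exact: measurable_funX.
  have cX : cond_centered P L (fun w => X w - k (L w)).
    apply: (cond_centered_ae mL _ _ ct).
      by apply: measurable_funB => //; exact: (measurableT_comp mk' mL).
    have alg (a b k0 k1 m : R) : m != 0 -> a ^+ 2 - k0 - 2 * (k1 / m) * (a * b - k1) =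
        a ^+ 2 - 2 * (k1 / m) * (a * b) + (k1 / m) ^+ 2 * m - (k0 - k1 ^+ 2 / m).
      by move=> m0; field.
    by apply: aeW => w; apply: alg; rewrite gt_eqF.
  have iX : P.-integrable setT (EFin \o X).
    have ik : P.-integrable setT (EFin \o (fun w => k (L w))).
      apply: (@ae_bounded_integrable _ _ _ _ _ 3).
        exact: (measurableT_comp mk' mL).
      apply: filterS3 kM kpM (delta_itv01 P mA mL) => w kw kpw /andP[d0 d1].
      have k2 : `|kappa wt (L w) ^+ 2 / (4 * M ^+ 2)| <= 1.
        rewrite ger0_norm; last by apply: divr_ge0; [exact: sqr_ge0|exact: ltW].
        rewrite ler_pdivrMr// mul1r -[leLHS]real_normK ?num_real//.
        have -> : 4 * M ^+ 2 = (2 * M) ^+ 2 by ring.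
        have M20 : 0 <= 2 * M by rewrite mulr_ge0// ltW.
        rewrite lerXn2r ?nnegrE//.
        by rewrite (le_trans kw)// ler_piMr// mulr_ge0// ltW.
      have kp2 : `|kappa prop (L w)| <= 2.
        by rewrite (le_trans kpw)// mulr1 ler_piMr.
      apply: (le_trans (ler_normB _ _)); apply: (le_trans (lerD kp2 k2)).
      exact: le3.
    have := integrableD measurableT cX.1 ik.
    by apply: eq_integrable => // w _ /=; rewrite -EFinD subrK.
  apply: (cond_centered_comp_ge0 mL mk' iX cX).
  apply: filterS (weight_deviation_le mZ mL mwt wtM) => w wM.
  rewrite /X; set a := prop _ - _; set b := wt _ - _ in wM *.
  have b2 : b ^+ 2 <= 4 * M ^+ 2.
    rewrite -[b ^+ 2]real_normK ?num_real//.
    have := normr_ge0 b; nra.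
  have := sqr_ge0 (a - t (L w) * b).
  have := ler_wpM2l (sqr_ge0 (t (L w))) b2.
  nra.
apply: filterS2 ke0 => w ke; rewrite subr_ge0; apply: le_trans.
by rewrite ler_pM2r ?invr_gt0// -[leRHS]real_normK ?num_real// lerXn2r// ?nnegrE ltW.
Qed.

Lemma regular_propensity (wt : TZ * TL -> R) :
  regular_weight P Z A L wt -> regular_weight P Z A L prop.
Proof.
move=> /regular_weight_bounds[M [e0 [M0 e00 mwt wtM ke0]]]; split.
- exact: measurable_propensity.
- exists 1; apply: filterS (propensity_itv01 P mZ mA mL) => w /andP[p0 p1].
  by rewrite ger0_norm.
- exists (e0 ^+ 2 / (4 * M ^+ 2)).
    by rewrite divr_gt0// ?exprn_gt0// mulr_gt0// exprn_gt0.
  apply: filterS (propensity_variance_lower_bound M0 e00 mwt wtM ke0) => w le.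
  exact: (le_trans le (ler_norm _)).
Qed.

Definition weight_ratio (wt : TZ * TL -> R) : TZ * TL -> R :=
  fun v => (wt v - rho wt v.2) / kappa wt v.2.

Section one_regular_weight.
Variable wt : TZ * TL -> R.
Hypothesis rwt : regular_weight P Z A L wt.

Lemma measurable_weight_ratio : measurable_fun setT (weight_ratio wt).
Proof.
have [M [e0 [M0 e00 mwt wtM ke0]]] := regular_weight_bounds rwt.
have [mk _] := cond_centered_kappa mZ mA mL mwt wtM.
apply: measurable_funM.
  apply: measurable_funB => //; apply: measurableT_comp => //.
  exact: (measurable_rho mZ mL mwt wtM).
by apply: measurable_funV; apply: measurableT_comp.
Qed.

Lemma weight_ratio_bounded :
  exists M : R, {ae P, forall w, `|weight_ratio wt (Z w, L w)| <= M}.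
Proof.
have [M [e0 [M0 e00 mwt wtM ke0]]] := regular_weight_bounds rwt.
exists (2 * M / e0).
apply: filterS2 (weight_deviation_le mZ mL mwt wtM) ke0 => w wM ke.
rewrite /weight_ratio normrM normfV; apply: ler_pM => //=.
by rewrite lef_pV2// posrE (lt_le_trans e00).
Qed.

Lemma cond_centered_weight_ratio : cond_centered P L (fun w =>
  weight_ratio wt (Z w, L w) * (prop (Z w, L w) - delta (L w)) - 1).
Proof.
have [M [e0 [M0 e00 mwt wtM ke0]]] := regular_weight_bounds rwt.
have [mk _] := cond_centered_kappa mZ mA mL mwt wtM.
have mki : measurable_fun setT (fun v => (kappa wt v)^-1) by exact: measurable_funV.
have kiM : {ae P, forall w, `|(kappa wt (L w))^-1| <= e0^-1}.
  by apply: filterS ke0 => w ke; rewrite normfV lef_pV2// posrE (lt_le_trans e00).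
apply: (cond_centered_ae mL _ _ (cond_centered_bounded_mul mL mki kiM
  (cond_centered_propensity_deviation mZ mA mL mwt wtM))).
  apply: measurable_funB => //; apply: measurable_funM.
    exact: (measurableT_comp measurable_weight_ratio (measurable_pair mZ mL)).
  apply: measurable_funB.
    exact: (measurableT_comp (measurable_propensity P mZ mA mL) (measurable_pair mZ mL)).
  exact: (measurableT_comp (measurable_delta P mA mL) mL).
apply: filterS ke0 => w ke.
have k0 : kappa wt (L w) != 0 by rewrite -normr_gt0 (lt_le_trans e00).
rewrite mulrBr mulVf// /weight_ratio /=; congr (_ - 1).
have alg (a b k : R) : k * (a * b) = b * k * a by ring.
exact: alg.
Qed.

End one_regular_weight.

Lemma cond_centered_weight_ratio_diff (wt : TZ * TL -> R) :
  regular_weight P Z A L wt -> cond_centered P L (fun w =>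
  (weight_ratio wt (Z w, L w) - weight_ratio prop (Z w, L w)) *
  weight_ratio prop (Z w, L w)).
Proof.
move=> rwt; have rp := regular_propensity rwt.
have [M [e0 [M0 e00 mwt wtM ke0]]] := regular_weight_bounds rp.
have [mk _] := cond_centered_kappa mZ mA mL mwt wtM.
have mki : measurable_fun setT (fun v => (kappa prop v)^-1) by exact: measurable_funV.
have kiM : {ae P, forall w, `|(kappa prop (L w))^-1| <= e0^-1}.
  by apply: filterS ke0 => w ke; rewrite normfV lef_pV2// posrE (lt_le_trans e00).
have c := cond_centered_bounded_mul mL mki kiM (cond_centeredB mL
  (cond_centered_weight_ratio rwt) (cond_centered_weight_ratio rp)).
have mr wt' : regular_weight P Z A L wt' ->
    measurable_fun setT (fun w => weight_ratio wt' (Z w, L w)).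
  move=> rwt'; exact: (measurableT_comp (measurable_weight_ratio rwt') (measurable_pair mZ mL)).
apply: (cond_centered_ae mL _ _ c).
  by apply: measurable_funM; [apply: measurable_funB|]; exact: mr.
(* Both ratios satisfy the same normalization against p - delta. The conditional mean of the
   propensity given L is delta almost surely, so dividing by [kappa prop] turns p - delta into its
   weight ratio. *)
apply: filterS (condexp_propensity_ae P mZ mA mL) => w rhoE.
have alg (a b x k : R) : k * (a * x - 1 - (b * x - 1)) = (a - b) * (x * k) by ring.
by rewrite alg; congr (_ * _); rewrite /weight_ratio /= rhoE.
Qed.

Lemma le_integral_weight_ratio (wt : TZ * TL -> R) (B : set TL) :
  regular_weight P Z A L wt -> measurable B ->
  (\int[P]_(w in L @^-1` B) (weight_ratio prop (Z w, L w) ^+ 2)%:E <=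
   \int[P]_(w in L @^-1` B) (weight_ratio wt (Z w, L w) ^+ 2)%:E)%E.
Proof.
move=> rwt mB; have rp := regular_propensity rwt.
have mLB := measurable_preimageT mL mB.
have ir2 wt' : regular_weight P Z A L wt' ->
    P.-integrable setT (EFin \o (fun w => weight_ratio wt' (Z w, L w) ^+ 2)).
  move=> rwt'; have [M rM] := weight_ratio_bounded rwt'.
  apply: (@ae_bounded_integrable _ _ _ _ _ (M ^+ 2)).
    apply: measurable_funX.
    exact: (measurableT_comp (measurable_weight_ratio rwt') (measurable_pair mZ mL)).
  apply: filterS rM => w rw; rewrite normrX lerXn2r ?nnegrE//.
  exact: le_trans rw.
have c := cond_centered_weight_ratio_diff rwt.
have ic := integrableZl measurableT 2 c.1.
have ip := ir2 _ rp.
(* Twice the cross term, whose integral over the event of L is 0, is added on the left; the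
   integrands then differ by a perfect square. *)
rewrite -[leLHS]adde0 -(mule0 2%:E) -(c.2 _ mB) -integralZl//; last first.
  by apply: integrableS c.1.
rewrite -integralD//; [|exact: integrableS ip|exact: integrableS ic].
have iS := integrableD measurableT ip ic.
apply: (ae_le_integral mLB iS (ir2 _ rwt)).
apply: aeW => w; set a := weight_ratio wt _; set b := weight_ratio prop _.
have alg (x y : R) : x ^+ 2 - (y ^+ 2 + 2 * ((x - y) * y)) = (x - y) ^+ 2 by ring.
by rewrite -subr_ge0 alg sqr_ge0.
Qed.

End regular_weighting_functions.

(** * The influence function *)

Section outcome.
Context d (T : measurableType d) (R : realType) (P : probability T R).
Context dZ (TZ : measurableType dZ) dL (TL : measurableType dL).
Variables (Z : T -> TZ) (A : T -> bool) (Y : T -> R) (L : T -> TL).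
Variable f : bool * TL -> R.
Hypotheses (mZ : measurable_fun setT Z) (mA : measurable_fun setT A).
Hypothesis mL : measurable_fun setT L.

Local Notation A01 := (fun w => (A w)%:R : R).
Local Notation W := (fun w => (Z w, L w)).
Local Notation delta := (condexp P L A01).
Local Notation prop := (propensity P Z A L).
Local Notation rho wt := (condexp P L (fun w => wt (Z w, L w))).
Local Notation kappa wt := (condcov P L A01 (fun w => wt (Z w, L w))).

Hypothesis intY : P.-integrable setT (EFin \o Y).
Hypothesis regular_exists : exists wt, regular_weight P Z A L wt.
Hypothesis mf : measurable_fun setT f.
Hypothesis intf : P.-integrable setT (EFin \o (fun w => f (A w, L w))).
Hypothesis f_solution : {ae P, forall w,
  condexp P W Y (Z w, L w) = condexp P W (fun w' => f (A w', L w')) (Z w, L w)}.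

Definition outcome_residual (w : T) : R := Y w - f (A w, L w).
Definition treatment_effect (l : TL) : R := f (true, l) - f (false, l).
Local Notation eps := outcome_residual.
Local Notation f1 := treatment_effect.

Let mW : measurable_fun setT W. Proof. exact: measurable_pair. Qed.

Let marm b : measurable_fun setT (fun l => f (b, l)).
Proof. by apply: measurableT_comp => //; exact: measurable_fun_pair. Qed.

Lemma measurable_treatment_effect : measurable_fun setT f1.
Proof. by apply: measurable_funB. Qed.

(** A binary treatment makes f(A, L) affine in A, so its conditional covariance with any weight is
    the slope at L times that of A. *)
Let f_decomp w : f (A w, L w) = f (false, L w) + (A w)%:R * f1 (L w).
Proof. by rewrite /treatment_effect; case: (A w) => /=; ring. Qed.

Lemma cond_centered_residual : cond_centered P W eps.
Proof.
have := cond_centeredB mW (cond_centered_condexp mW intY) (cond_centered_condexp mW intf).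
apply: (cond_centered_ae mW).
  apply: measurable_funB; first exact: integrable_measurable intY.
  exact: integrable_measurable intf.
by apply: filterS f_solution => w ->; rewrite /eps opprB addrA subrK.
Qed.

(* Regularity bounds delta away from 0 and 1, so the integrability of f(A, L)
   passes to f(b, L). *)
Lemma integrable_arm b : P.-integrable setT (EFin \o (fun w => f (b, L w))).
Proof.
have [wt rwt] := regular_exists.
have [c c0 dc] := regular_delta_bounds mZ mA mL rwt.
have mA01 := measurable_treatment (R:=R) mA.
have iA := integrable_treatment P mA.
have md := measurable_delta P mA mL.
have cd := cond_centered_delta P mA mL.
have i1 : P.-integrable setT (EFin \o (cst 1 : T -> R)).
  exact: finite_measure_integrable_cst.
case: b.
(* The product A f(1, L) equals A f(A, L), which is dominated by |f(A, L)|; the other arm is treated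
   alike with 1 - A. *)
- apply: (integrable_comp_lower_bound mL (g := fun l => f (true, l)) c0 md _ _ iA cd) => //.
  + by apply: filterS dc => w /andP[].
  + rewrite (_ : _ \o _ = EFin \o (fun w => (A w)%:R * f (A w, L w))).
      apply: (ae_bounded_integrableM (M := 1) mA01) => //.
      by apply: aeW => w; case: (A w); rewrite ?normr1 ?normr0.
    by apply/funext => w /=; case: (A w); rewrite ?mulr1 ?mul1r// mulr0 mul0r.
- have mA1 : measurable_fun setT (fun w => 1 - (A w)%:R : R) by exact: measurable_funB.
  apply: (integrable_comp_lower_bound mL (X := fun w => 1 - (A w)%:R)
    (k := fun l => 1 - delta l) (g := fun l => f (false, l)) c0) => //.
  + exact: measurable_funB.
  + by move=> w; case: (A w); rewrite ?subrr ?subr0.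
  + exact: (integrableB measurableT i1 iA).
  + apply: (cond_centered_ae mL _ _ (cond_centeredN mL cd)).
      apply: measurable_funB => //; apply: measurable_funB => //.
      exact: (measurableT_comp md mL).
    by apply: aeW => w; ring.
  + by apply: filterS dc => w /andP[_]; rewrite lerBrDr addrC -lerBrDr.
  + rewrite (_ : _ \o _ = EFin \o (fun w => (1 - (A w)%:R) * f (A w, L w))).
      apply: (ae_bounded_integrableM (M := 1) mA1) => //.
      by apply: aeW => w; case: (A w); rewrite ?subrr ?subr0 ?normr1 ?normr0.
    by apply/funext => w /=; case: (A w); rewrite ?subrr ?subr0 ?mulr1 ?mul1r// mulr0 mul0r.
Qed.

Lemma integrable_treatment_effect : P.-integrable setT (EFin \o (fun w => f1 (L w))).
Proof. exact: (integrableB measurableT (integrable_arm true) (integrable_arm false)). Qed.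

Lemma condexp_outcome_ae :
  {ae P, forall w, condexp P L Y (L w) = f (false, L w) + delta (L w) * f1 (L w)}.
Proof.
have mf1 := measurable_treatment_effect.
have md := measurable_delta P mA mL.
apply: (condexp_ae_eq (k := fun l => f (false, l) + delta l * f1 l) mL) => //.
  by apply: measurable_funD => //; exact: measurable_funM.
have cd := cond_centered_delta P mA mL.
(* The slope [f1] is integrable but possibly unbounded; the product is integrable because the other
   factor, A - delta, is bounded by 1. *)
have cfd : cond_centered P L (fun w => f1 (L w) * ((A w)%:R - delta (L w))).
  apply: cond_centeredM => //.
  have := ae_bounded_integrableM (integrable_measurable cd.1)
    (treatment_deviation_le P mA mL) integrable_treatment_effect.
  by apply: eq_integrable => // w _ /=; rewrite mulrC.
apply: (cond_centered_ae mL _ _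
  (cond_centeredD mL (cond_centered_of_pair cond_centered_residual) cfd)).
  apply: measurable_funB; first exact: integrable_measurable intY.
  apply: (measurableT_comp (f := fun l => f (false, l) + delta l * f1 l) _ mL).
  by apply: measurable_funD => //; exact: measurable_funM.
by apply: aeW => w; rewrite /eps f_decomp; ring.
Qed.

Section one_regular_weight.
Variable wt : TZ * TL -> R.
Hypothesis rwt : regular_weight P Z A L wt.

Let mwtW : measurable_fun setT (fun w => wt (Z w, L w)).
Proof. by have [mwt _ _] := rwt; exact: (measurableT_comp mwt mW). Qed.

(** Almost surely Y - eta(L) = e + g(L) (A - delta(L)). The residual is orthogonal to bounded
    functions of [(Z, L)], so only the second term contributes to the covariance. Dividing by
    [kappa] then shows that gamma is the same for all regular weights. *)
Let mprod : measurable_fun setT (condcov P L Y (fun w => wt (Z w, L w))) /\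
  {ae P, forall w, condcov P L Y (fun w => wt (Z w, L w)) (L w) =
    kappa wt (L w) * f1 (L w)}.
Proof.
have [M [e0 [M0 e00 mwt wtM ke0]]] := regular_weight_bounds rwt.
have mrho := measurable_rho mZ mL mwt wtM.
have mdev : measurable_fun setT (fun w => wt (Z w, L w) - rho wt (L w)).
  by apply: measurable_funB => //; exact: (measurableT_comp mrho mL).
have devM := weight_deviation_le mZ mL mwt wtM.
have [mk ck] := cond_centered_condcov mZ mA mL mwt wtM.
have [kM _] := kappa_le mZ mA mL mwt wtM.
have mf1 := measurable_treatment_effect.
have cY := cond_centered_condexp mL intY.
have iYdev : P.-integrable setT (EFin \o (fun w =>
    (Y w - condexp P L Y (L w)) * (wt (Z w, L w) - rho wt (L w)))).
  have := ae_bounded_integrableM mdev devM cY.1.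
  by apply: eq_integrable => // w _ /=; rewrite mulrC.
split; first exact: (measurable_condexp mL iYdev).
apply: (condexp_ae_eq (k := fun l => kappa wt l * f1 l) mL _ iYdev).
  exact: measurable_funM.
have mdevW : measurable_fun setT (fun v : TZ * TL => wt v - rho wt v.2).
  by apply: measurable_funB => //; exact: measurableT_comp.
have ce := cond_centered_of_pair (cond_centered_bounded_mul mW mdevW devM
  cond_centered_residual).
have cf : cond_centered P L (fun w => f1 (L w) *
    (((A w)%:R - delta (L w)) * (wt (Z w, L w) - rho wt (L w)) - kappa wt (L w))).
  apply: cond_centeredM => //.
  have mX := integrable_measurable ck.1.
  have XM : {ae P, forall w, `|((A w)%:R - delta (L w)) *
      (wt (Z w, L w) - rho wt (L w)) - kappa wt (L w)| <= 2 * M + 2 * M}.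
    apply: filterS3 devM kM (filterI (delta_itv01 P mA mL) (treatment_deviation_le P mA mL)) =>
      w dM kw [/andP[d0 d1] Ad].
    have M20 : 0 <= 2 * M by rewrite mulr_ge0// ltW.
    apply: (le_trans (ler_normB _ _)); apply: lerD.
      by rewrite normrM -[leRHS]mul1r; exact: ler_pM.
    by rewrite (le_trans kw)// ler_piMr.
  have := ae_bounded_integrableM mX XM integrable_treatment_effect.
  by apply: eq_integrable => // w _ /=; rewrite mulrC.
apply: (cond_centered_ae mL _ _ (cond_centeredD mL ce cf)).
  apply: measurable_funB; first exact: (integrable_measurable iYdev).
  by apply: measurable_funM; apply: measurableT_comp.
apply: filterS condexp_outcome_ae => w ->.
have alg (y fA f0 a d1 g x k : R) : fA = f0 + a * g ->
    x * (y - fA) + g * ((a - d1) * x - k) = (y - (f0 + d1 * g)) * x - k * g.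
  by move=> ->; ring.
exact/alg/f_decomp.
Qed.

Lemma measurable_nu_gamma :
  measurable_fun setT (nu_gamma (true_nuisance P Z A Y L wt)).
Proof.
have [M [e0 [M0 e00 mwt wtM ke0]]] := regular_weight_bounds rwt.
have [mk _] := cond_centered_condcov mZ mA mL mwt wtM.
by apply: measurable_funM; [exact: mprod.1|exact: measurable_funV].
Qed.

Lemma nu_gamma_ae :
  {ae P, forall w, nu_gamma (true_nuisance P Z A Y L wt) (L w) = f1 (L w)}.
Proof.
have [M [e0 [M0 e00 mwt wtM ke0]]] := regular_weight_bounds rwt.
apply: filterS2 mprod.2 ke0 => w /= -> ke.
by rewrite mulrC mulKf// -normr_gt0 (lt_le_trans e00).
Qed.

Lemma true_psiE : true_psi P Z A Y L wt = fine (\int[P]_w (f1 (L w))%:E)%E.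
Proof.
rewrite /true_psi unlock; congr fine; apply: ae_eq_integral => //.
- by apply/measurable_EFinP; exact: (measurableT_comp measurable_nu_gamma).
- by apply/measurable_EFinP; exact: (measurableT_comp measurable_treatment_effect).
- by apply: filterS nu_gamma_ae => w -> _.
Qed.

(** The last term of [phi] subtracts r (A - delta) gamma, which cancels exactly the treatment part r
    g (A - delta) of r (Y - eta); only the residual remains multiplied by r. *)
Lemma true_phi_ae : {ae P, forall w, true_phi P Z A Y L wt w =
  f1 (L w) - fine (\int[P]_w (f1 (L w))%:E)%E +
  weight_ratio P Z A L wt (Z w, L w) * eps w}.
Proof.
apply: filterS2 nu_gamma_ae condexp_outcome_ae => w gE etaE.
rewrite /true_phi /phi true_psiE gE /= etaE /weight_ratio /=.
have alg (y fA f0 a d1 g x k s : R) : fA = f0 + a * g ->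
    x * k * (y - (f0 + d1 * g)) - s + (1 - x * (a - d1) * k) * g =
    g - s + x * k * (y - fA).
  by move=> ->; ring.
exact/alg/f_decomp.
Qed.

Lemma measurable_true_phi : measurable_fun setT (true_phi P Z A Y L wt).
Proof.
have [M [e0 [M0 e00 mwt wtM ke0]]] := regular_weight_bounds rwt.
have [mk _] := cond_centered_condcov mZ mA mL mwt wtM.
have mkL : measurable_fun setT (fun w => (kappa wt (L w))^-1).
  by apply: measurable_funV; exact: measurableT_comp.
have mdev : measurable_fun setT (fun w => wt (Z w, L w) - rho wt (L w)).
  by apply: measurable_funB => //; exact: (measurableT_comp (measurable_rho mZ mL mwt wtM) mL).
have mAd : measurable_fun setT (fun w => (A w)%:R - delta (L w)).
  exact: integrable_measurable (cond_centered_delta P mA mL).1.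
have mYe : measurable_fun setT (fun w => Y w - condexp P L Y (L w)).
  exact: integrable_measurable (cond_centered_condexp mL intY).1.
rewrite /true_phi /phi /=; apply: measurable_funD.
  apply: measurable_funB => //.
  by apply: measurable_funM => //; exact: measurable_funM.
apply: measurable_funM; last exact: (measurableT_comp measurable_nu_gamma).
apply: measurable_funB => //.
by apply: measurable_funM => //; exact: measurable_funM.
Qed.

Lemma expectation_true_phi_sqr :
  ('E_P[fun w => (true_phi P Z A Y L wt w ^+ 2)%R] =
   \int[P]_w ((f1 (L w) - fine (\int[P]_w (f1 (L w))%:E)%E +
     weight_ratio P Z A L wt (Z w, L w) * eps w) ^+ 2)%:E)%E.
Proof.
have me := integrable_measurable cond_centered_residual.1.
rewrite unlock; apply: ae_eq_integral => //.
- by apply/measurable_EFinP; apply: measurable_funX; exact: measurable_true_phi.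
- apply/measurable_EFinP/measurable_funX/measurable_funD.
    apply: measurable_funB => //.
    exact: (measurableT_comp measurable_treatment_effect mL).
  apply: measurable_funM => //.
  exact: (measurableT_comp (measurable_weight_ratio mZ mA mL rwt) mW).
- by apply: filterS true_phi_ae => w -> _.
Qed.

End one_regular_weight.

End outcome.

(** * The residual variance under homoscedasticity *)

Section residual_variance.
Context d (T : measurableType d) (R : realType) (P : probability T R).
Context dZ (TZ : measurableType dZ) dL (TL : measurableType dL).
Variables (Z : T -> TZ) (A : T -> bool) (L : T -> TL) (e : T -> R).
Hypotheses (mZ : measurable_fun setT Z) (mA : measurable_fun setT A).
Hypotheses (mL : measurable_fun setT L) (me : measurable_fun setT e).

Local Notation W := (fun w => (Z w, L w)).
Local Notation prop := (propensity P Z A L).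
Local Notation S := (econdexp P W (fun w => (e w ^+ 2)%:E)).

Hypothesis residual_indep : condindep P (fun w => S (Z w, L w)) Z L.

(** Three reductions: e^2 is replaced by the positive part of its conditional expectation [S], which
    then acts as a weight; events of [S] are replaced by functions of L; the remaining comparison of
    squared ratios over events of L is the minimality of the propensity. *)
Lemma le_integral_residual_variance (wt : TZ * TL -> R) (k : TL -> R) :
  regular_weight P Z A L wt -> measurable_fun setT k -> (forall l, 0 <= k l) ->
  (\int[P]_w (k (L w) * (weight_ratio P Z A L prop (Z w, L w) * e w) ^+ 2)%:E <=
   \int[P]_w (k (L w) * (weight_ratio P Z A L wt (Z w, L w) * e w) ^+ 2)%:E)%E.
Proof.
move=> rwt mk k0; have rp := regular_propensity mZ mA mL rwt.
have mW := measurable_pair mZ mL.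
have me2 : measurable_fun setT (fun w => e w ^+ 2) by exact: measurable_funX.
have mS : measurable_fun setT S.
  have [] // : is_condexp P W (EFin \o (fun w => e w ^+ 2)) S.
  by apply: xgetPex (is_condexp_ge0 P mW me2 _) => w; exact: sqr_ge0.
have mSW : measurable_fun setT (fun w => S (Z w, L w)) by exact: measurableT_comp.
have mr wt' : regular_weight P Z A L wt' -> measurable_fun setT
    (fun v : TZ * TL => k v.2 * weight_ratio P Z A L wt' v ^+ 2).
  move=> rwt'; apply: measurable_funM; first exact: measurableT_comp.
  by apply: measurable_funX; exact: measurable_weight_ratio.
have kr0 wt' (v : TZ * TL) : 0 <= k v.2 * weight_ratio P Z A L wt' v ^+ 2.
  by apply: mulr_ge0 => //; exact: sqr_ge0.
have towerE wt' : regular_weight P Z A L wt' ->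
    (\int[P]_w (k (L w) * (weight_ratio P Z A L wt' (Z w, L w) * e w) ^+ 2)%:E =
     \int[P]_w (Order.max (S (Z w, L w)) 0 *
       (k (L w) * weight_ratio P Z A L wt' (Z w, L w) ^+ 2)%:E))%E.
  move=> rwt'; transitivity (\int[P]_w
      ((k (L w) * weight_ratio P Z A L wt' (Z w, L w) ^+ 2)%:E * (e w ^+ 2)%:E))%E.
    by apply: eq_integral => w _; rewrite -EFinM exprMn mulrA.
  rewrite (integral_econdexp_weight P mW
    (k := fun v => (k v.2 * weight_ratio P Z A L wt' v ^+ 2)%:E) me2) //.
  - by apply: eq_integral => w _; rewrite funeposE muleC.
  - by move=> w; exact: sqr_ge0.
  - by apply/measurable_EFinP; exact: mr.
  - by move=> v; rewrite lee_fin; exact: kr0.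
rewrite [leLHS](towerE prop rp) [leRHS](towerE wt rwt).
(* The conditioning variable is here the conditional variance S(Z, L) itself, so it suffices to
   compare k r^2 over the events of [S]. *)
apply: (ge0_le_integral_comp mSW (k := fun s => Order.max s 0%E)
  (X := fun w => (k (L w) * weight_ratio P Z A L prop (Z w, L w) ^+ 2)%:E)
  (X' := fun w => (k (L w) * weight_ratio P Z A L wt (Z w, L w) ^+ 2)%:E)).
- by apply/measurable_EFinP; exact: (measurableT_comp (mr _ rp) mW).
- by move=> w; rewrite lee_fin; exact: (kr0 prop (Z w, L w)).
- by apply/measurable_EFinP; exact: (measurableT_comp (mr _ rwt) mW).
- by move=> w; rewrite lee_fin; exact: (kr0 wt (Z w, L w)).
- exact: measurable_maxe.
- by move=> s; rewrite le_max lexx orbT.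
move=> C mC; have indC := condindep_indicator_ae mZ mL mS mC residual_indep.
have mE := measurable_preimageT mSW mC.
set q := condprob P L _ in indC.
have mq : measurable_fun setT q.
  exact: (measurable_condexp mL (integrable_indicator P mE)).
(* Almost surely q(L) is the indicator of the event, but the chosen version may be negative
   elsewhere; the absolute value makes the weight nonnegative at every point. *)
have restrictE wt' : regular_weight P Z A L wt' ->
    (\int[P]_(w in (fun w => S (Z w, L w)) @^-1` C)
       (k (L w) * weight_ratio P Z A L wt' (Z w, L w) ^+ 2)%:E =
     \int[P]_w ((`|q (L w)| * k (L w))%:E *
       (weight_ratio P Z A L wt' (Z w, L w) ^+ 2)%:E))%E.
  move=> rwt'; have mr2 : measurable_fun setT
      (fun w => weight_ratio P Z A L wt' (Z w, L w) ^+ 2).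
    apply: measurable_funX.
    exact: (measurableT_comp (measurable_weight_ratio mZ mA mL rwt') mW).
  have mkL : measurable_fun setT (fun w => k (L w)) by exact: measurableT_comp.
  have mqL : measurable_fun setT (fun w => `|q (L w)|).
    by apply: measurableT_comp => //; exact: measurableT_comp.
  transitivity (\int[P]_w (\1_C (S (Z w, L w)) *
      (k (L w) * weight_ratio P Z A L wt' (Z w, L w) ^+ 2))%:E)%E.
    rewrite integral_mkcond; apply: eq_integral => w _.
    rewrite patchE -[w \in _]/(S (Z w, L w) \in C) indicE.
    by case: ifP => _; rewrite ?mul1r// mul0r.
  apply: ae_eq_integral => //.
  - apply/measurable_EFinP/measurable_funM; last exact: measurable_funM.
    by apply: measurableT_comp mSW; exact: measurable_indic.
  - apply: emeasurable_funM; apply/measurable_EFinP => //.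
    exact: measurable_funM.
  - apply: filterS indC => w qE _; rewrite -EFinM -mulrA -qE; congr (EFin (_ * _)).
    by rewrite indicE ger0_norm.
rewrite [leLHS](restrictE prop rp) [leRHS](restrictE wt rwt).
have mr2 wt' : regular_weight P Z A L wt' -> measurable_fun setT
    (EFin \o (fun w => weight_ratio P Z A L wt' (Z w, L w) ^+ 2)).
  move=> rwt'; apply/measurable_EFinP/measurable_funX.
  exact: (measurableT_comp (measurable_weight_ratio mZ mA mL rwt') mW).
apply: (ge0_le_integral_comp mL (k := fun l => (`|q l| * k l)%:E) (mr2 _ rp) _ (mr2 _ rwt)).
- by move=> w; rewrite lee_fin; exact: sqr_ge0.
- by move=> w; rewrite lee_fin; exact: sqr_ge0.
- apply/measurable_EFinP/measurable_funM => //.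
  exact: measurableT_comp.
- by move=> l; rewrite lee_fin mulr_ge0.
- by move=> B mB; exact: le_integral_weight_ratio.
Qed.

End residual_variance.

Theorem proposition3p2
  (d : measure_display) (T : measurableType d) (R : realType)
  (P : probability T R)
  (dZ : measure_display) (TZ : measurableType dZ)
  (dU : measure_display) (TU : measurableType dU)
  (dL : measure_display) (TL : measurableType dL)
  (Z : {RV P >-> TZ}) (U : {RV P >-> TU}) (L : {RV P >-> TL})
  (A : {RV P >-> bool}) (Y : {RV P >-> R}) (Ypot : bool -> {RV P >-> R})
  (f : bool * TL -> R)
  (intY : P.-integrable setT (fun w => (Y w)%:E))
  (consistency : {ae P, forall w, Y w = Ypot (A w) w})
  (latent_ignorability : forall a : bool,
     condindep P (Ypot a) (fun w => (A w, Z w)) (fun w => (U w, L w)))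
  (iv_independence : condindep P Z U L)
  (regular_exists : exists pi : TZ * TL -> R, regular_weight P Z A L pi)
  (mf : measurable_fun setT f)
  (intf : P.-integrable setT (fun w => (f (A w, L w))%:E))
  (f_solution : {ae P, forall w,
     condexp P (fun w' => (Z w', L w')) Y (Z w, L w) =
     condexp P (fun w' => (Z w', L w')) (fun w' => f (A w', L w')) (Z w, L w)})
  (residual_indep :
     condindep P
       (fun w => econdexp P (fun w' => (Z w', L w'))
          (fun w' => ((Y w' - f (A w', L w')) ^+ 2)%:E) (Z w, L w))
       Z L) :
  regular_weight P Z A L (propensity P Z A L) /\
  forall pi : TZ * TL -> R, regular_weight P Z A L pi ->
    ('E_P[fun w => ((true_phi P Z A Y L (propensity P Z A L) w) ^+ 2)%R] <=
     'E_P[fun w => ((true_phi P Z A Y L pi w) ^+ 2)%R])%E.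
Proof.
have mZ : measurable_fun setT Z by [].
have mA : measurable_fun setT A by [].
have mL : measurable_fun setT L by [].
have [wt0 rwt0] := regular_exists.
have rp := regular_propensity mZ mA mL rwt0; split; [exact: rp|move=> wt rwt].
have ce := cond_centered_residual mZ mL intY intf f_solution.
have mf1 := measurable_treatment_effect mf.
rewrite [leLHS](expectation_true_phi_sqr mZ mA mL intY regular_exists mf intf f_solution rp).
rewrite [leRHS](expectation_true_phi_sqr mZ mA mL intY regular_exists mf intf f_solution rwt).
have [M1 r1M] := weight_ratio_bounded mZ mL rp.
have [M2 r2M] := weight_ratio_bounded mZ mL rwt.
have r1M' : {ae P, forall w,
    `|weight_ratio P Z A L (propensity P Z A L) (Z w, L w)| <= Num.max M1 M2}.
  by apply: filterS r1M => w rM; rewrite le_max rM.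
have r2M' : {ae P, forall w, `|weight_ratio P Z A L wt (Z w, L w)| <= Num.max M1 M2}.
  by apply: filterS r2M => w rM; rewrite le_max rM orbT.
(* The centering constant is the same for every regular weight, by [true_psiE], so both influence
   functions share this function of L and differ only in the ratio multiplying the residual. *)
pose g l := treatment_effect f l - fine (\int[P]_w (treatment_effect f (L w))%:E)%E.
have mg : measurable_fun setT g by exact: measurable_funB.
have me := integrable_measurable ce.1.
exact: (le_integral_square_noise (measurable_pair mZ mL) measurable_snd ce mg
  (measurable_weight_ratio mZ mA mL rp) (measurable_weight_ratio mZ mA mL rwt) r1M' r2M'
  (fun k mk k0 => le_integral_residual_variance mZ mA mL me residual_indep rwt mk k0)).
Qed.
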